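(* Let $f \in C((0,\infty);(0,\infty))$ be asymptotically increasing with $\lim_{x\to\infty} f(x)/x = \infty$. Let $w \in C([0,\infty);[0,\infty))$ with $w \in L^1([0,\infty))$, $w(0)=0$, and $w(t)>0$ for $t\in(0,\delta]$ for some $\delta>0$. Suppose \[ \int_\eta^\infty \frac{du}{\sqrt{\int_0^u f(s)\,ds}} = \infty \quad \text{for all } \eta>0. \] Then solutions of \[ x'(t) = \int_0^t w(t-s) f(x(s))\,ds, \quad t \ge 0; \qquad x(0)>0, \] satisfy $x \in C([0,\infty);(0,\infty))$. If in addition $f$ preserves superexponential growth, then \[ \lim_{t\to\infty} \frac{F_U(x(t))}{t} = 0, \] where $F_U(x) = \int_1^x \frac{du}{\sqrt{\int_0^u f(s)\,ds}}$ for $x>0$.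
   Context: ''$f$ is asymptotically increasing'' means that there is a continuous increasing function $\phi:(0,\infty)\to(0,\infty)$ with $f(x)/\phi(x)\to 1$ as $x\to\infty$. A function $g \in C((0,\infty);(0,\infty))$ exhibits superexponential growth if $g(x)\to\infty$ as $x\to\infty$ and $\lim_{x\to\infty} g(x-\epsilon)/g(x) = 0$ for each $\epsilon>0$. A function $\phi \in C((0,\infty);(0,\infty))$ preserves superexponential growth if for every $g$ exhibiting superexponential growth and every $\epsilon>0$, $\lim_{x\to\infty}\phi(g(x-\epsilon))/\phi(g(x)) = 0$. *)

(* Defs.v *)
From HB Require Import structures.
From mathcomp Require Import all_boot all_order all_algebra.
From mathcomp Require Import all_classical all_reals all_analysis.
Set Implicit Arguments. Unset Strict Implicit. Unset Printing Implicit Defensive.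
Import Order.TTheory GRing.Theory Num.Theory.
Import numFieldNormedType.Exports.
Local Open Scope classical_set_scope.
Local Open Scope ring_scope.

Section Defs.
Variable R : realType.
Local Notation mu := (@lebesgue_measure R).

Definition asymp_increasing (f : R -> R) : Prop :=
  exists phi : R -> R,
    {within `]0, +oo[, continuous phi} /\
    (forall x, 0 < x -> 0 < phi x) /\
    (forall x y, 0 < x -> x < y -> phi x < phi y) /\
    (f x / phi x @[x --> +oo] --> (1:R)).

Definition superexp_growth (g : R -> R) : Prop :=
  {within `]0, +oo[, continuous g} /\
  (forall x, 0 < x -> 0 < g x) /\
  (g x @[x --> +oo] --> +oo) /\
  (forall eps, 0 < eps -> g (x - eps) / g x @[x --> +oo] --> (0:R)).

(* phi in C((0,oo);(0,oo)) preserves superexponential growth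
   (the continuity/positivity of phi is assumed separately). *)
Definition preserves_superexp (phi : R -> R) : Prop :=
  forall g : R -> R, superexp_growth g ->
  forall eps, 0 < eps -> phi (g (x - eps)) / phi (g x) @[x --> +oo] --> (0:R).

Definition int0 (f : R -> R) (u : R) : \bar R :=
  (\int[mu]_(s in `]0%R, u]) (f s)%:E)%E.

(* The integrand u |-> 1 / sqrt (\int_0^u f); by convention it is 0 when
   the inner integral is +oo (1/sqrt(+oo) = 0). *)
Definition osgood_integrand (f : R -> R) (u : R) : R :=
  match int0 f u with
  | EFin r => 1 / Num.sqrt r
  | _ => 0
  end.

Definition F_U (f : R -> R) (x : R) : R :=
  if 1 <= x then Rintegral mu `[1, x] (osgood_integrand f)
  else - Rintegral mu `[x, 1] (osgood_integrand f).

Definition volterra_rhs (w f x : R -> R) (t : R) : R :=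
  Rintegral mu `[0, t] (fun s => w (t - s) * f (x s)).

Definition local_solution (w f : R -> R) (x0 T : R) (x : R -> R) : Prop :=
  {within `[0, T[, continuous x} /\ x 0 = x0 /\
  (forall t, 0 < t < T -> derivable x t 1 /\ derive1 x t = volterra_rhs w f x t).

Definition global_solution (w f : R -> R) (x0 : R) (x : R -> R) : Prop :=
  {within `[0, +oo[, continuous x} /\ x 0 = x0 /\
  (forall t, 0 < t -> derivable x t 1 /\ derive1 x t = volterra_rhs w f x t).

End Defs.

(* Main.v *)
(** With Phi a nondecreasing majorant of f comparable to f, F u = int_0^u f and G' = 1 / sqrt F,
    suppose x' <= c int_0^t h with h <= Phi(x). Then x lies below z = z0 + c int int h, which
    satisfies z'' <= c Phi(z) <= c K f(z); multiplying by z' gives z'^2 <= 2 c K F(z), that is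
    G(x(t)) <= G(z(t)) <= G(z0) + sqrt(2 c K) t, and the Osgood condition G -> oo excludes blow-up.
    The same bound holds uniformly for the approximations with delayed right-hand side, so a
    limit of them along an ultrafilter on nat is a global solution.
    For the growth rate, superlinearity of f makes x superexponential; since f preserves this,
    the recent past dominates the convolution, where w is small because w(0) = 0. Hence the
    constant c can be taken arbitrarily small for large t. *)
Require Import Defs.
From HB Require Import structures.
From mathcomp Require Import all_boot all_order all_algebra.
From mathcomp Require Import all_classical all_reals all_analysis.
From mathcomp Require Import measurable_realfun ring lra.
Set Implicit Arguments. Unset Strict Implicit. Unset Printing Implicit Defensive.
Import Order.TTheory GRing.Theory Num.Theory.
Import numFieldNormedType.Exports.
Local Open Scope classical_set_scope.
Local Open Scope ring_scope.

(** * One-variable calculus *)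

Section Calculus.
Variable R : realType.
Local Notation mu := (@lebesgue_measure R).
Implicit Types (g P p : R -> R) (a b c t : R).

(** Several obstacles shape the argument. [f] is not monotone, while bounding the memory by the
    present value needs monotonicity; the detour through [Phi] costs the factor [K]. [f] may be
    singular at 0: finiteness of its integral near 0 is extracted from the Osgood condition, whose
    integrand is 0 by convention when the inner integral is infinite. [w] is merely continuous, so
    [x'] cannot be differentiated; the energy argument is run on [z], which is twice differentiable
    because the kernel has been replaced by a constant bound. [f] is not assumed Lipschitz, so
    existence rests on compactness: a delay makes the approximations explicit, and limits along an
    ultrafilter take the place of subsequences. For the growth rate the energy argument starts at a
    late time, where the velocity of [z] is not zero. Raising [z0] then makes the initial energy
    nonpositive; this changes only an additive constant in the bound for [G (x t)], which is
    negligible against [t]. *)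

Lemma is_derive_continuous P t d : is_derive t 1 P d -> {for t, continuous P}.
Proof.
move=> dP; apply: differentiable_continuous; apply/derivable1_diffP.
exact: ex_derive.
Qed.

Lemma is_derive_continuousT P p :
  (forall t, is_derive t 1 P (p t)) -> continuous P.
Proof. by move=> dP t; exact: is_derive_continuous (dP t). Qed.

Lemma increment_le P p a b c : a <= b -> {within `[a, b], continuous P} ->
  (forall t, a < t < b -> is_derive t 1 P (p t)) ->
  (forall t, a < t < b -> p t <= c) -> P b - P a <= c * (b - a).
Proof.
move=> ab cP dP pc; move: (ab); rewrite le_eqVlt => /predU1P[->|ab'].
  by rewrite !subrr mulr0.
have dP' t : t \in `]a, b[ -> is_derive t 1 P (p t) by rewrite in_itv/= => /dP.
have [t + ->] := MVT ab' dP' cP.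
by rewrite in_itv/= => /pc tc; rewrite ler_wpM2r// subr_ge0.
Qed.

Lemma increment_ge P p a b c : a <= b -> {within `[a, b], continuous P} ->
  (forall t, a < t < b -> is_derive t 1 P (p t)) ->
  (forall t, a < t < b -> c <= p t) -> c * (b - a) <= P b - P a.
Proof.
move=> ab cP dP pc; move: (ab); rewrite le_eqVlt => /predU1P[->|ab'].
  by rewrite !subrr mulr0.
have dP' t : t \in `]a, b[ -> is_derive t 1 P (p t) by rewrite in_itv/= => /dP.
have [t + ->] := MVT ab' dP' cP.
by rewrite in_itv/= => /pc tc; rewrite ler_wpM2r// subr_ge0.
Qed.

Lemma continuous_segment_integrable g a b :
  continuous g -> mu.-integrable `[a, b] (EFin \o g).
Proof.
move=> cg; apply: continuous_compact_integrable; first exact: segment_compact.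
exact: continuous_subspaceT.
Qed.

(** The signed integral from 0 is a difference of two integrals over segments, at most one of them
    nondegenerate. Having primitives on the whole line spares one-sided derivatives everywhere
    below. *)
Lemma primitive_exists g : continuous g ->
  exists P, forall t, is_derive t 1 P (g t).
Proof.
move=> cg.
have ig a b := @continuous_segment_integrable g a b cg.
have split a b c : a <= b -> b <= c ->
    Rintegral mu `[a, c] g = Rintegral mu `[a, b] g + Rintegral mu `[b, c] g.
  move=> ab bc.
  have := @Rintegral_itvB R g (BLeft a) (BRight c) b (ig a c).
  rewrite !bnd_simp => /(_ ab bc).
  rewrite Rintegral_itv_obnd_cbnd; last first.
    by apply: integrableS (ig b c) => //; exact: subset_itv_oc_cc.
  by move=> <-; rewrite addrC subrK.
exists (fun t => Rintegral mu `[0, t] g - Rintegral mu `[t, 0] g) => t.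
(* With [m] to the left of both [t] and 0, the signed integral equals the integral from [m] up to a
   constant near [t], whatever the sign of [t]. *)
set m := Num.min (t - 1) (-1).
have mt : m < t by rewrite gt_min ltrBlDr ltrDl ltr01.
have m0 : m < 0 by rewrite gt_min oppr_lt0 ltr01 orbT.
have [dQ Qt] := @continuous_FTC1_closed R g m t (t + 1)
  (ltac:(by rewrite ltrDl ltr01)) (ig _ _) mt (cg t).
have DQ : is_derive t 1 (fun s => Rintegral mu `[m, s] g - Rintegral mu `[m, 0] g) (g t).
  rewrite -[g t]subr0; apply: is_deriveB; rewrite -Qt derive1E; exact/derivableP.
apply: near_eq_is_derive DQ.
near=> s.
have ms : m <= s by apply/ltW; near: s; exact: lt_nbhsr.
have [s0|s0] := leP 0 s.
  rewrite (split m 0 s (ltW m0) s0) addrC addKr.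
  move: s0; rewrite le_eqVlt => /predU1P[<-|s0].
    by rewrite subrr set_itv1 Rintegral_set1.
  by rewrite [X in _ - X](_ : _ = 0) ?subr0// set_itv_ge ?Rintegral_set0// bnd_simp -ltNge.
rewrite (split m s 0 ms (ltW s0)) opprD addNKr.
by rewrite [X in X - _](_ : _ = 0) ?sub0r// set_itv_ge ?Rintegral_set0// bnd_simp -ltNge.
Unshelve. all: by end_near. Qed.

Lemma Rintegral_primitive g P a b : continuous g ->
  (forall t, is_derive t 1 P (g t)) -> a <= b ->
  Rintegral mu `[a, b] g = P b - P a.
Proof.
move=> cg dP; rewrite le_eqVlt => /predU1P[->|ab].
  by rewrite set_itv1 Rintegral_set1 subrr.
have cP := @is_derive_continuousT _ _ dP.
rewrite /Rintegral (@continuous_FTC2 _ g P)//.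
- exact: continuous_subspaceT.
- split.
  + by move=> t _; exact: ex_derive.
  + by apply: cvg_at_right_filter; exact: cP.
  + by apply: cvg_at_left_filter; exact: cP.
- by move=> t _; rewrite derive1E; exact: derive_val.
Qed.

Lemma Rintegral_le_cst g a b c : continuous g -> a <= b ->
  (forall t, a <= t <= b -> g t <= c) -> Rintegral mu `[a, b] g <= c * (b - a).
Proof.
move=> cg ab gc; have [P dP] := primitive_exists cg.
rewrite (Rintegral_primitive cg dP ab).
apply: (@increment_le P g) => //.
- exact/continuous_subspaceT/(is_derive_continuousT dP).
- by move=> t /andP[ta tb]; apply: gc; rewrite !ltW.
Qed.

Lemma le_Rintegral_segment g1 g2 a b : continuous g1 -> continuous g2 ->
  (forall t, a <= t <= b -> g1 t <= g2 t) ->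
  Rintegral mu `[a, b] g1 <= Rintegral mu `[a, b] g2.
Proof.
move=> c1 c2 g12; by apply: le_Rintegral => //; exact: continuous_segment_integrable.
Qed.

Lemma Rintegral_dist g1 g2 a b c : continuous g1 -> continuous g2 -> a <= b ->
  (forall t, a <= t <= b -> `|g1 t - g2 t| <= c) ->
  `|Rintegral mu `[a, b] g1 - Rintegral mu `[a, b] g2| <= c * (b - a).
Proof.
move=> c1 c2 ab g12.
rewrite -RintegralB//; try exact: continuous_segment_integrable.
have c12 : continuous (fun t => g1 t - g2 t).
  by move=> t; apply: cvgB; [exact: c1|exact: c2].
apply: le_trans.
  by apply: le_normr_Rintegral => //; exact: continuous_segment_integrable c12.
apply: Rintegral_le_cst => // t.
exact: (continuous_comp (c12 t) (@norm_continuous _ _ _)).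
Qed.

Lemma continuous_bounded_segment g a b : continuous g ->
  exists2 M, 0 < M & forall t, a <= t <= b -> `|g t| <= M.
Proof.
move=> cg; have [ab|ab] := leP a b; last first.
  by exists 1 => // t /andP[at_ tb]; have := le_lt_trans (le_trans at_ tb) ab; rewrite ltxx.
have [|c _ gc] := @EVT_max _ (fun t => `|g t|) a b ab.
  apply: continuous_subspaceT => t.
  by apply: continuous_comp; [exact: cg|exact: norm_continuous].
exists (`|g c| + 1); first by rewrite ltr_wpDl.
move=> t tab; rewrite (le_trans (gc t _)) ?in_itv//=.
by rewrite lerDl.
Qed.

Lemma continuous_pos_segment g a b : continuous g -> (forall t, 0 < g t) ->
  exists2 m, 0 < m & forall t, a <= t <= b -> m <= g t.
Proof.
move=> cg gp; have [|M M0 hM] := @continuous_bounded_segment (fun t => (g t)^-1) a b.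
  by move=> t; apply: cvgV; [rewrite gt_eqF|exact: cg].
exists M^-1; first by rewrite invr_gt0.
move=> t /hM; rewrite gtr0_norm ?invr_gt0// => h.
by rewrite -[leRHS]invrK lef_pV2// posrE invr_gt0.
Qed.

(** Only [s] is confined to the segment; [t] is free, so that a degenerate segment gives plain
    continuity at a point. *)
Lemma unif_continuous_segment g a b e : continuous g -> 0 < e ->
  exists2 d, 0 < d &
    forall s t, a <= s <= b -> `|s - t| < d -> `|g s - g t| < e.
Proof.
move=> cg e0.
have /compact_near_coveringP/(_ R 0^'+
   (fun d s => forall t, `|s - t| < d -> `|g s - g t| < e)) := @segment_compact R a b.
case.
  move=> s _.
  have /cvgrPdist_lt/(_ (e / 2)) := cg s; rewrite divr_gt0// => /(_ isT).
  move=> /nbhs_ballP[r /= r0 hr].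
  exists (ball s (r / 2), [set d | d < r / 2]) => /=.
    split; first by apply: nbhsx_ballx; rewrite divr_gt0.
    by apply: nbhs_right_lt; rewrite divr_gt0.
  move=> [s' d] /= [ss' dr] t s't.
  have h1 : `|g s - g s'| < e / 2.
    by apply: hr; apply: lt_trans ss' _; rewrite ltr_pdivrMr// ltr_pMr// ltr1n.
  have h2 : `|g s - g t| < e / 2.
    apply: hr; rewrite /ball/= [r]splitr.
    rewrite (le_lt_trans (ler_distD s' _ _))// ltrD// (lt_trans s't)//.
  by rewrite (le_lt_trans (ler_distD (g s) _ _))// [e]splitr ltrD// distrC.
move=> d0 /= d00 hd0.
exists (d0 / 2); first by rewrite divr_gt0.
move=> s t sab; apply: hd0 => /=.
- by rewrite /= sub0r normrN gtr0_norm ?divr_gt0// ltr_pdivrMr// ltr_pMr// ltr1n.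
- by rewrite divr_gt0.
- by rewrite /= in_itv.
Qed.

End Calculus.

(** * Energy estimate *)

Section Energy.
Variables (R : realType) (F f G : R -> R) (a : R).
Implicit Types u v t s : R.
Hypothesis dF : forall u, is_derive u 1 F (f u).
Hypothesis F_gt0 : forall u, a <= u -> 0 < F u.
Hypothesis dG : forall u, a <= u -> is_derive u 1 G (Num.sqrt (F u))^-1.

(** The last hypothesis makes the energy nonpositive at [T0]; a nonzero initial velocity is thus
    allowed. *)
Lemma energy_bound (z p r : R -> R) (B T0 T1 : R) : T0 <= T1 -> 0 <= B ->
  (forall t, is_derive t 1 z (p t)) -> (forall t, is_derive t 1 p (r t)) ->
  (forall t, T0 <= t <= T1 -> 0 <= p t) ->
  (forall t, T0 <= t <= T1 -> r t <= B * f (z t)) ->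
  a <= z T0 -> p T0 ^+ 2 <= 2 * B * F (z T0) ->
  G (z T1) <= G (z T0) + Num.sqrt (2 * B) * (T1 - T0).
Proof.
move=> T01 B0 dz dp p0 rB az0 pF.
have cz := is_derive_continuousT dz.
have cp := is_derive_continuousT dp.
have azt t : T0 <= t <= T1 -> a <= z t.
  move=> /andP[t0 t1]; apply: le_trans az0 _; rewrite -subr_ge0.
  have := @increment_ge _ z p T0 t 0 t0 (continuous_subspaceT cz).
  rewrite mul0r; apply.
  by move=> s /andP[s0 s1]; apply: p0; rewrite (ltW s0) (le_trans (ltW s1)).
(* [p ^ 2 - 2 B F(z)] is the energy: its derivative is [2 p (r - B f(z)) <= 0] *)
pose E t := p t * p t - 2 * B * F (z t).
have dFz t : is_derive t 1 (F \o z) (f (z t) * p t).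
  exact: is_derive1_comp (dF _) (dz _).
have dE t : is_derive t 1 E (2 * p t * (r t - B * f (z t))).
  rewrite (_ : 2 * p t * _ = (p t *: r t + p t *: r t) - (2 * B) *: (f (z t) * p t)).
    exact: is_deriveB (is_deriveM (dp t) (dp t)) (is_deriveZ (2 * B) (dFz t)).
  by rewrite /GRing.scale/=; ring.
have cE := is_derive_continuousT dE.
have pE t : T0 <= t <= T1 -> p t <= Num.sqrt (2 * B) * Num.sqrt (F (z t)).
  move=> t01; have /andP[t0 t1] := t01.
  have : E t - E T0 <= 0 * (t - T0).
    apply: (increment_le t0 (continuous_subspaceT cE) (fun s _ => dE s)).
    move=> s /andP[s0 s1].
    have s01 : T0 <= s <= T1 by rewrite (ltW s0) (le_trans (ltW s1)).
    by rewrite mulr_ge0_le0// ?mulr_ge0// ?p0// subr_le0 rB.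
  rewrite mul0r => Et.
  have {}Et : p t ^+ 2 <= 2 * B * F (z t).
    by move: Et pF; rewrite /E -!expr2; lra.
  rewrite -sqrtrM ?mulr_ge0// -[leLHS]ger0_norm ?p0// -sqrtr_sqr.
  by rewrite ler_wsqrtr.
rewrite -lerBlDl.
apply: (@increment_le _ (G \o z) (fun t => (Num.sqrt (F (z t)))^-1 * p t)) => //.
- apply: continuous_in_subspaceT => t; rewrite inE/= in_itv/= => t01.
  apply: continuous_comp; first exact: cz.
  exact: is_derive_continuous (dG (azt _ t01)).
- move=> t /andP[t0 t1]; apply: is_derive1_comp.
  by apply: dG; apply: azt; rewrite !ltW.
- move=> t /andP[t0 t1].
  have t01 : T0 <= t <= T1 by rewrite !ltW.
  by rewrite mulrC ler_pdivrMr ?sqrtr_gt0 ?F_gt0 ?azt// pE.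
Qed.

Lemma osgood_primitive_homo u v : a <= u -> u <= v -> G u <= G v.
Proof.
move=> au uv; rewrite -subr_ge0.
have := @increment_ge _ G (fun u => (Num.sqrt (F u))^-1) u v 0 uv.
rewrite mul0r; apply.
- apply: continuous_in_subspaceT => t; rewrite inE/= in_itv/= => /andP[ut _].
  exact: is_derive_continuous (dG (le_trans au ut)).
- by move=> t /andP[ut _]; apply: dG; rewrite (le_trans au)// ltW.
- by move=> t _; rewrite invr_ge0 sqrtr_ge0.
Qed.

(** Only [x T0 <= z0] ties [z0] to [x], so [z0] can be raised until the energy condition at [T0]
    holds. [h] is kept apart from [f] along [x] because in the delayed equation it is evaluated at
    an earlier time. Monotonicity of [Phi] carries [h <= Phi(x)] over to [h <= Phi(z)]. *)
Lemma integral_inequality_bound (x x' h H Phi : R -> R) (c K T0 T1 z0 : R) :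
  T0 <= T1 -> 0 <= c -> 0 <= K ->
  {homo Phi : u v / u <= v} -> (forall u, Phi u <= K * f u) ->
  {within `[T0, T1], continuous x} ->
  (forall t, T0 < t < T1 -> is_derive t 1 x (x' t)) ->
  (forall t, T0 < t < T1 -> x' t <= c * H t) ->
  (forall t, is_derive t 1 H (h t)) ->
  (forall t, T0 <= t <= T1 -> 0 <= H t) ->
  (forall t, T0 <= t <= T1 -> h t <= Phi (x t)) ->
  x T0 <= z0 -> a <= z0 -> a <= x T1 -> (c * H T0) ^+ 2 <= 2 * (c * K) * F z0 ->
  G (x T1) <= G z0 + Num.sqrt (2 * (c * K)) * (T1 - T0).
Proof.
move=> T01 c0 K0 Phi_homo PhiK cx dx xH dH H0 hPhi xz0 az0 ax1 HF.
have [Q dQ] := primitive_exists (is_derive_continuousT dH).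
pose z t := z0 + c * (Q t - Q T0).
have dz t : is_derive t 1 z (c * H t).
  rewrite -[c * H t]add0r; apply: is_deriveD; apply: is_deriveZ.
  by rewrite -[H t]subr0; apply: is_deriveB; exact: dQ.
have dp t : is_derive t 1 (fun t => c * H t) (c * h t).
  by apply: is_deriveZ; exact: dH.
have zT0 : z T0 = z0 by rewrite /z subrr mulr0 addr0.
have xz t : T0 <= t <= T1 -> x t <= z t.
  move=> /andP[t0 t1].
  have : (z T0 - x T0) <= (z t - x t); last by rewrite zT0; lra.
  rewrite -subr_ge0.
  have := @increment_ge _ (fun t => z t - x t) (fun t => c * H t - x' t) T0 t 0 t0.
  rewrite mul0r; apply.
  - move=> s; apply: continuousB.
      exact/continuous_subspaceT/(is_derive_continuousT dz).
    by apply: (continuous_subspaceW _ cx); exact: subset_itvl.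
  - move=> s /andP[s0 s1]; apply: is_deriveB.
    by apply: dx; rewrite s0 (lt_le_trans s1).
  - by move=> s /andP[s0 s1]; rewrite subr_ge0 xH// s0 (lt_le_trans s1).
apply: (@le_trans _ _ (G (z T1))).
  by apply: osgood_primitive_homo => //; apply: xz; rewrite T01 lexx.
rewrite -zT0; apply: (@energy_bound z (fun t => c * H t) (fun t => c * h t)) => //.
- by rewrite mulr_ge0.
- by move=> t t01; rewrite mulr_ge0// H0.
- move=> t t01; rewrite -mulrA ler_wpM2l// (le_trans (hPhi _ t01))//.
  by rewrite (le_trans _ (PhiK _))// Phi_homo// xz.
- by rewrite zT0.
- by rewrite zT0.
Qed.

End Energy.

(** * Convolutions and delayed equations *)

Section Convolution.
Variable R : realType.
Local Notation mu := (@lebesgue_measure R).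
Implicit Types (w g h y : R -> R) (s t u T : R).

Definition wconv w g u : R :=
  Rintegral mu `[0, u] (fun s => w (u - s) * g s).

Lemma continuous_wconv_integrand w g u : continuous w -> continuous g ->
  continuous (fun s => w (u - s) * g s).
Proof.
move=> cw cg s; apply: cvgM; last exact: cg.
apply: continuous_comp; last exact: cw.
by apply: cvgB; [exact: cvg_cst|exact: cvg_id].
Qed.

(** As [w] vanishes for negative arguments, the upper limit can be frozen; continuity under the
    integral sign needs a domain independent of [u]. *)
Lemma wconv_widen w g u T : (forall t, t <= 0 -> w t = 0) -> u <= T ->
  wconv w g u = Rintegral mu `[0, T] (fun s => w (u - s) * g s).
Proof.
move=> w0 uT; rewrite /wconv Rintegral_mkcond [RHS]Rintegral_mkcond.
congr Rintegral; apply/funext => s; rewrite !patchE.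
have [su|su] := boolP (s \in `[0, u]%classic).
  rewrite ifT//; move: su; rewrite !inE/= !in_itv/= => /andP[-> /=].
  by move=> /le_trans; exact.
case: ifPn => // sT; have us : u < s.
  rewrite ltNge; apply: contra su => su; move: sT.
  by rewrite !inE/= !in_itv/= => /andP[-> _].
by rewrite w0 ?mul0r// subr_le0 ltW.
Qed.

Lemma wconv_continuous w g : continuous w -> (forall t, t <= 0 -> w t = 0) ->
  continuous g -> continuous (wconv w g).
Proof.
move=> cw w0 cg t; set T := `|t| + 1.
have T0 : 0 < T by rewrite ltr_wpDl.
have tT : t \in `](- T), T[%classic.
  by rewrite inE/= in_itv/= -ltr_norml ltrDl.
(* For [u] in []-T, T[] and [s] in [[0, T]] the argument [u - s] stays in [[-2T, 2T]], so [W * |g|]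
   dominates. *)
have [W W0 hW] := continuous_bounded_segment (- (2 * T)) (2 * T) cw.
pose J u := Rintegral mu `[0, T] (fun s => w (u - s) * g s).
have cJ : {for t, continuous J}.
  apply: (@continuity_under_integral R _ _ mu (fun u s => w (u - s) * g s)
    `[0, T]%classic _ (- T) T _ _ (fun s => W * `|g s|)) => //.
  - move=> u _; apply: continuous_segment_integrable.
    exact: continuous_wconv_integrand.
  - apply: aeW => s _ u _; apply: cvgM; last exact: cvg_cst.
    apply: continuous_comp; last exact: cw.
    by apply: cvgB; [exact: cvg_id|exact: cvg_cst].
  - apply: continuous_segment_integrable => s; apply: cvgM; first exact: cvg_cst.
    by apply: continuous_comp; [exact: cg|exact: norm_continuous].
  - move=> u; rewrite /= in_itv/= => /andP[uT1 uT2].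
    apply: aeW => s; rewrite /= in_itv/= => /andP[s0 sT].
    by rewrite normrM ler_wpM2r// hW//; lra.
have cE : wconv w g t = J t.
  by apply: wconv_widen => //; move: tT; rewrite inE/= in_itv/= => /andP[_ /ltW].
rewrite /continuous_at cE; apply: cvg_trans cJ; apply: near_eq_cvg; near=> u.
apply/esym/wconv_widen => //.
apply/ltW; near: u; apply: lt_nbhsl.
by move: tT; rewrite inE/= in_itv/= => /andP[].
Unshelve. all: by end_near. Qed.

Lemma wconv_ge0 w g u : (forall t, 0 <= w t) ->
  (forall s, 0 <= s <= u -> 0 <= g s) -> 0 <= wconv w g u.
Proof.
move=> w0 g0; apply: Rintegral_ge0 => s; rewrite /= in_itv/= => su.
by rewrite mulr_ge0// g0.
Qed.

Lemma eq_wconv w g h u : (forall s, 0 <= s <= u -> g s = h s) ->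
  wconv w g u = wconv w h u.
Proof.
move=> gh; apply: eq_Rintegral => s; rewrite inE/= in_itv/= => su.
by rewrite gh.
Qed.

Lemma wconv_le w g H W u : continuous w -> continuous g ->
  (forall t, is_derive t 1 H (g t)) -> 0 <= u ->
  (forall t, 0 <= t <= u -> w t <= W) -> (forall s, 0 <= s <= u -> 0 <= g s) ->
  wconv w g u <= W * (H u - H 0).
Proof.
move=> cw cg dH u0 wW g0.
have cWg : continuous (fun s => W * g s).
  by move=> s; apply: cvgM; [exact: cvg_cst|exact: cg].
have dWH t : is_derive t 1 (fun s => W * H s) (W * g t).
  by apply: is_deriveZ; exact: dH.
rewrite mulrBr -(Rintegral_primitive cWg dWH u0).
apply: le_Rintegral_segment => //; first exact: continuous_wconv_integrand.
by move=> s /andP[s0 su]; rewrite ler_wpM2r ?g0 ?s0// wW//; lra.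
Qed.

Lemma wconv_dist w g h W e u : continuous w -> continuous g -> continuous h ->
  0 <= u -> (forall t, 0 <= t <= u -> `|w t| <= W) ->
  (forall s, 0 <= s <= u -> `|g s - h s| <= e) ->
  `|wconv w g u - wconv w h u| <= W * e * u.
Proof.
move=> cw cg ch u0 wW gh.
rewrite -[X in W * e * X]subr0; apply: Rintegral_dist => //.
- exact: continuous_wconv_integrand.
- exact: continuous_wconv_integrand.
move=> s /andP[s0 su]; rewrite -mulrBr normrM ler_pM// ?wW ?gh//; lra.
Qed.

End Convolution.

(** * Approximation by equations with delay *)

Section Delayed.
Variable R : realType.
Local Notation mu := (@lebesgue_measure R).
Variables (w f : R -> R) (x0 : R).
Hypotheses (cw : continuous w) (w0 : forall t : R, t <= 0 -> w t = 0).
Hypotheses (w_ge0 : forall t : R, 0 <= w t).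
Hypotheses (cf : continuous f) (f_ge0 : forall u : R, 0 <= f u).
Implicit Types (y : R -> R) (s t u T d : R).

Let delayed d y s := f (y (s - d)).

Definition delayed_step d y t :=
  x0 + Rintegral mu `[0, Num.max t 0] (wconv w (delayed d y)).

(** The equation is asked only up to [T], as far as finitely many iterations reach; regularity and
    the constant history hold on the whole line. *)
Definition delayed_solution d T y := [/\ continuous y, {homo y : s t / s <= t},
  (forall t, t <= 0 -> y t = x0) & forall t, t <= T -> y t = delayed_step d y t].

Lemma continuous_delayed d y : continuous y -> continuous (delayed d y).
Proof.
move=> cy t; apply: continuous_comp; last exact: cf.
apply: continuous_comp; last exact: cy.
by apply: cvgB; [exact: cvg_id|exact: cvg_cst].
Qed.

Lemma delayed_step_primitive d y : continuous y ->
  exists2 P, forall t, is_derive t 1 P (wconv w (delayed d y) t) &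
             forall t, delayed_step d y t = x0 + (P (Num.max t 0) - P 0).
Proof.
move=> cy; have cc := wconv_continuous cw w0 (@continuous_delayed d y cy).
have [P dP] := primitive_exists cc; exists P => // t.
by rewrite /delayed_step (Rintegral_primitive cc dP)// le_max lexx orbT.
Qed.

Lemma delayed_step_regular d y : continuous y ->
  [/\ continuous (delayed_step d y), {homo delayed_step d y : s t / s <= t} &
      forall t, t <= 0 -> delayed_step d y t = x0].
Proof.
move=> cy; have [P dP PE] := delayed_step_primitive d cy.
have -> : delayed_step d y = fun t => x0 + (P (Num.max t 0) - P 0).
  exact/funext.
split.
- move=> t; apply: cvgD; first exact: cvg_cst.
  apply: cvgB; last exact: cvg_cst.
  apply: continuous_comp; last exact: is_derive_continuous (dP _).
  by apply: continuous_max; [exact: cvg_id|exact: cvg_cst].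
- move=> s t st; rewrite lerD2l lerD2r -subr_ge0.
  have mst : Num.max s 0 <= Num.max t 0.
    by rewrite ge_max !le_max st lexx/= orbT.
  have := @increment_ge _ P (wconv w (delayed d y)) _ _ 0 mst
    (continuous_subspaceT (is_derive_continuousT dP)).
  rewrite mul0r; apply.
  by move=> u _; apply: wconv_ge0 => // v _; exact: f_ge0.
- by move=> t t0; rewrite max_r// subrr addr0.
Qed.

Lemma delayed_solution_exists d T : 0 < d -> exists y, delayed_solution d T y.
Proof.
move=> d0; pose y k := iter k (delayed_step d) (cst x0).
have y_reg k : [/\ continuous (y k), {homo y k : s t / s <= t} &
    forall t, t <= 0 -> y k t = x0].
  elim: k => [|k [cy _ _]]; last exact: delayed_step_regular.
  by split => //=; exact: cst_continuous.
(* the delay lets each iteration settle the solution on one more step of length d *)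
have yS k t : t <= k%:R * d -> y k.+1 t = y k t.
  elim: k t => [t|k IH t tk].
    rewrite mul0r => t0; have [_ _ ->//] := y_reg 1%N.
  rewrite /= /delayed_step; congr (_ + _); apply: eq_Rintegral => u.
  rewrite inE/= in_itv/= => /andP[u0 ut]; apply: eq_wconv => s /andP[s0 su].
  rewrite /delayed; congr f; apply: IH.
  rewrite lerBlDr; apply: (le_trans su); apply: (le_trans ut).
  rewrite ge_max; apply/andP; split; first by move: tk; rewrite -natr1; lra.
  by rewrite addr_ge0 ?mulr_ge0// ltW.
pose k := Num.bound `|T / d|.
exists (y k); have [cy hy y0] := y_reg k; split => // t tT.
rewrite -[RHS]/(y k.+1 t) yS//; apply: (le_trans tT).
rewrite -ler_pdivrMr//; apply: (le_trans (ler_norm _)).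
exact/ltW/archi_boundP.
Qed.

End Delayed.

(** * Existence *)

Lemma ultra_fmap (T V : Type) (h : T -> V) (U : set_system T) :
  UltraFilter U -> UltraFilter (fmap h U).
Proof.
move=> UU; split; first exact: fmap_proper_filter.
move=> G GG UG; apply/seteqP; split => [A GA|]; last exact: UG.
have [//|UnA] := in_ultra_setVsetC (h @^-1` A) UU.
have : G (A `&` ~` A) by apply: filterI => //; exact: UG.
by rewrite setICr => /filter_not_empty.
Qed.

Section Existence.
Variable R : realType.
Local Notation mu := (@lebesgue_measure R).
Variables (w f : R -> R) (x0 : R).
Hypotheses (cw : continuous w) (w0 : forall t : R, t <= 0 -> w t = 0).
Hypotheses (w_ge0 : forall t : R, 0 <= w t).
Hypotheses (cf : continuous f) (f_ge0 : forall u : R, 0 <= f u).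
Hypothesis apriori : forall T : R, 0 <= T -> exists M : R, forall d y, 0 < d ->
  delayed_solution w f x0 d T y -> y T <= M.
Implicit Types (y x : R -> R) (s t u T d : R).

Lemma delayed_solution_le d T T' y : T <= T' ->
  delayed_solution w f x0 d T' y -> delayed_solution w f x0 d T y.
Proof.
by move=> TT' [cy hy y0 yE]; split => // t tT; apply: yE; exact: le_trans TT'.
Qed.

(** The a priori bound confines [y] to [[x0, M]], so its derivative is at most [W * C * T], and
    neither constant depends on the delay. The pair lets a single use of choice select both. *)
Lemma delayed_solution_lipschitz T : 0 <= T -> exists ML : R * R, 0 <= ML.2 /\
  forall d y, 0 < d -> delayed_solution w f x0 d T y ->
    (forall t, t <= T -> x0 <= y t <= ML.1) /\
    (forall s t, s <= t -> t <= T -> y t - y s <= ML.2 * (t - s)).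
Proof.
move=> T0; have [M hM] := apriori T0.
have [C C0 hC] := continuous_bounded_segment x0 M cf.
have [W W0 hW] := continuous_bounded_segment 0 T cw.
have L0 : 0 <= W * C * T by rewrite !mulr_ge0// ltW.
exists (M, W * C * T); split => // d y d0 sy.
have [cy hy y0 yE] := sy.
have bnd t : t <= T -> x0 <= y t <= M.
  move=> tT; apply/andP; split; last first.
    by rewrite (le_trans (hy _ _ tT))// (hM d).
  have [t0|/ltW t0] := leP t 0; first by rewrite y0.
  by rewrite -(y0 0 (lexx _)) hy.
split => // s t st tT.
have [P dP PE] := delayed_step_primitive x0 cw w0 cf d cy.
rewrite !yE ?(le_trans st)// !PE.
have mst : Num.max s 0 <= Num.max t 0.
  by rewrite ge_max !le_max st lexx/= orbT.
have mT : Num.max t 0 <= T by rewrite ge_max tT.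
apply: (@le_trans _ _ (P (Num.max t 0) - P (Num.max s 0))); first by lra.
apply: (@le_trans _ _ (W * C * T * (Num.max t 0 - Num.max s 0))); last first.
  rewrite ler_wpM2l//.
  have [t0|t0] := leP t 0; have [s0|s0] := leP s 0; lra.
apply: (increment_le mst (continuous_subspaceT (is_derive_continuousT dP)) (fun t _ => dP t)).
move=> u /andP[su ut].
have u0 : 0 <= u by apply: le_trans (ltW su); rewrite le_max lexx orbT.
have uT : u <= T by rewrite (le_trans (ltW ut)).
apply: (@le_trans _ _ (W * C * (u - 0))); last first.
  by rewrite subr0 ler_wpM2l// mulr_ge0// ltW.
apply: Rintegral_le_cst => //.
  exact: continuous_wconv_integrand cw (continuous_delayed (d := d) cf cy).
move=> v /andP[v0 vu]; rewrite ler_pM//.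
  by rewrite (le_trans (ler_norm _))// hW//; lra.
by rewrite (le_trans (ler_norm _))// hC// bnd//; lra.
Qed.

(** The approximation of index [n] has delay [1 / (n + 1)] and solves its equation up to time [n].
    Compactness of [[x0, M]] gives pointwise limits along an ultrafilter finer than [\oo]. The
    common Lipschitz constants make the convergence uniform on segments, which lets the double
    integral pass to the limit. *)
Theorem volterra_exists : exists x, [/\ continuous x, forall t, x0 <= x t &
  forall t, 0 <= t ->
    x t = x0 + Rintegral mu `[0, t] (wconv w (fun s => f (x s)))].
Proof.
have /choice[ML hML] : forall T, exists ML : R * R, 0 <= T -> 0 <= ML.2 /\
  forall d y, 0 < d -> delayed_solution w f x0 d T y ->
    (forall t, t <= T -> x0 <= y t <= ML.1) /\
    (forall s t, s <= t -> t <= T -> y t - y s <= ML.2 * (t - s)).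
  move=> T; have [T0|T0] := leP 0 T.
    by have [ml hml] := delayed_solution_lipschitz T0; exists ml.
  by exists (0, 0).
pose d n : R := n.+1%:R^-1.
have d0 n : 0 < d n by rewrite invr_gt0.
have /choice[y hy] : forall n, exists y, delayed_solution w f x0 (d n) n%:R y.
  by move=> n; exact: delayed_solution_exists.
have [U [UU sU]] := ultraFilterLemma (F := \oo) _.
have UF : ProperFilter U by exact: ultra_proper.
have solU T : \forall n \near U, delayed_solution w f x0 (d n) T (y n).
  apply: sU; near=> n; apply: delayed_solution_le (hy n).
  by near: n; exact: nbhs_infty_ger.
have bndU T : 0 <= T -> \forall n \near U,
    (forall t, t <= T -> x0 <= y n t <= (ML T).1) /\
    (forall s t, s <= t -> t <= T -> 0 <= y n t - y n s <= (ML T).2 * (t - s)).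
  move=> T0; apply: filterS (solU T) => n sy.
  have [b l] := (hML T T0).2 _ _ (d0 n) sy; split => // s t st tT.
  by rewrite l// andbT subr_ge0; have [_ + _ _] := sy; apply.
have /choice[x hx] : forall t, exists l : R, y n t @[n --> U] --> l.
  move=> t; have T0 : 0 <= Num.max t 0 by rewrite le_max lexx orbT.
  have := @segment_compact R x0 (ML (Num.max t 0)).1; rewrite compact_ultra.
  move=> /(_ (fmap (y ^~ t) U) (ultra_fmap _ UU)) [|l [_ yl]]; last by exists l.
  apply: filterS (bndU _ T0) => n [b _].
  by rewrite /= in_itv/= b// le_max lexx.
have xbnd T t : 0 <= T -> t <= T -> x0 <= x t <= (ML T).1.
  move=> T0 tT; apply/andP; split.
    apply: ler_cvg_to (cvg_cst x0) (hx t) _.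
    by apply: filterS (bndU T T0) => n [/(_ t tT)/andP[]].
  apply: ler_cvg_to (hx t) (cvg_cst (ML T).1) _.
  by apply: filterS (bndU T T0) => n [/(_ t tT)/andP[]].
have xlip T s t : 0 <= T -> s <= t -> t <= T ->
    0 <= x t - x s <= (ML T).2 * (t - s).
  move=> T0 st tT.
  have hxx : (y n t - y n s) @[n --> U] --> x t - x s by exact: cvgB.
  apply/andP; split.
    apply: ler_cvg_to (cvg_cst 0) hxx _.
    by apply: filterS (bndU T T0) => n [_ /(_ s t st tT)/andP[]].
  apply: ler_cvg_to hxx (cvg_cst ((ML T).2 * (t - s))) _.
  by apply: filterS (bndU T T0) => n [_ /(_ s t st tT)/andP[]].
have lipN (z : R -> R) T : (forall s t, s <= t -> t <= T ->
      0 <= z t - z s <= (ML T).2 * (t - s)) ->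
    forall s t, s <= T -> t <= T -> `|z t - z s| <= (ML T).2 * `|t - s|.
  move=> hz s t sT tT; have [st|/ltW ts] := leP s t.
    by have /andP[h1 h2] := hz s t st tT; rewrite (ger0_norm h1) ger0_norm ?subr_ge0.
  have /andP[h1 h2] := hz t s ts sT.
  by rewrite distrC [`|t - s|]distrC (ger0_norm h1) ger0_norm ?subr_ge0.
have cx : continuous x.
  move=> t; apply/cvgrPdist_le => e e0; set T := `|t| + 1.
  have T0 : 0 <= T by rewrite addr_ge0.
  have [L0 _] := hML T T0.
  have L1 : 0 < (ML T).2 + 1 by rewrite ltr_wpDl.
  near=> u.
  have uT : u <= T.
    by apply/ltW; near: u; apply: lt_nbhsl; rewrite ltr_pwDr// ler_norm.
  have tT : t <= T by rewrite ler_wpDr// ler_norm.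
  apply: le_trans (lipN x T (fun s t => xlip T s t T0) u t uT tT) _.
  apply: (@le_trans _ _ (((ML T).2 + 1) * `|t - u|)).
    by rewrite ler_wpM2r// lerDl.
  rewrite mulrC -ler_pdivlMr//; near: u.
  apply/nbhs_ballP; exists (e / ((ML T).2 + 1)) => /=; first by rewrite divr_gt0.
  by move=> v /ltW.
(* Equi-Lipschitz bounds and compactness upgrade pointwise to uniform convergence, with three errors
   of [e / 3]. The horizon [T + 1] leaves room for points of the covering balls beyond [T]. *)
have unif T e : 0 <= T -> 0 < e ->
    \forall n \near U, forall s, 0 <= s <= T -> `|x s - y n s| <= e.
  move=> T0 e0; set T' := T + 1.
  have T'0 : 0 <= T' by rewrite addr_ge0.
  have [L0 _] := hML T' T'0; set L := (ML T').2 in L0 *.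
  have L1 : 0 < L + 1 by rewrite ltr_wpDl.
  have /compact_near_coveringP cov := @segment_compact R 0 T.
  have : \forall n \near U, `[0, T] `<=` [set s | `|x s - y n s| <= e].
    apply: (cov nat U (fun n s => `|x s - y n s| <= e)) => s.
    rewrite /= in_itv/= => /andP[s0 sT].
    pose r := Num.min 1 (e / 3 / (L + 1)).
    have r0 : 0 < r by rewrite lt_min ltr01 !divr_gt0.
    exists (ball s r, [set n | `|x s - y n s| <= e / 3 /\ forall s t, s <= t ->
      t <= T' -> 0 <= y n t - y n s <= L * (t - s)]) => /=.
      split; first exact: nbhsx_ballx.
      have h1 : \forall n \near U, `|x s - y n s| <= e / 3.
        by have /cvgrPdist_le := hx s; apply; rewrite divr_gt0.
      by apply: filterS2 h1 (bndU T' T'0) => n h1 [_ h2].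
    move=> [s' n] [] /= ss' [ys yl].
    have sr : L * `|s - s'| <= e / 3.
      apply: (@le_trans _ _ ((L + 1) * `|s - s'|)).
        by rewrite ler_wpM2r// lerDl.
      rewrite mulrC -ler_pdivlMr//; apply: le_trans (ltW ss') _.
      by rewrite ge_min lexx orbT.
    have s1 : `|s - s'| <= 1.
      by apply: le_trans (ltW ss') _; rewrite ge_min lexx.
    have s'T : s' <= T' by move: s1; rewrite ler_norml /T'; lra.
    have sT' : s <= T' by rewrite /T'; lra.
    have h1 := lipN x T' (fun s t => xlip T' s t T'0) s s' sT' s'T.
    have h2 := lipN (y n) T' yl s' s s'T sT'.
    move: h1; rewrite -/L [`|s' - s|]distrC => h1; rewrite -/L in h2.
    have -> : x s' - y n s' = (x s' - x s) + (x s - y n s) + (y n s - y n s').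
      by ring.
    apply: le_trans (ler_normD _ _) _.
    have := ler_normD (x s' - x s) (x s - y n s); lra.
  by apply: filterS => n hn s s0T; apply: hn; rewrite /= in_itv.
exists x; split => // [t|t t0].
  have T0 : 0 <= Num.max t 0 by rewrite le_max lexx orbT.
  by have /andP[] := xbnd _ t T0 (ltac:(by rewrite le_max lexx)).
apply: (cvg_unique (@Rhausdorff R) (hx t)).
apply/cvgrPdist_le => e e0.
have [W W0 hW] := continuous_bounded_segment 0 t cw.
(* An error in [f] is multiplied by at most [W * t] in the convolution and by [t] in the outer
   integral; adding 1 keeps the divisor positive at [t = 0]. *)
have K0 : 0 < W * t * t + 1 by rewrite ltr_wpDl// !mulr_ge0// ltW.
have e'0 : 0 < e / (W * t * t + 1) by rewrite divr_gt0.
set e' := e / _ in e'0.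
have [r r0 hr] := unif_continuous_segment x0 (ML t).1 cf e'0.
have [L0 _] := hML t t0; set L := (ML t).2 in L0.
have L1 : 0 < L + 1 by rewrite ltr_wpDl.
(* The delay moves [y n] by at most [L * d n]; the other [r / 2] is left for the distance from [y n]
   to [x]. *)
have dU : \forall n \near U, (L + 1) * d n < r / 2.
  apply: sU; near=> n; rewrite mulrC -ltr_pdivlMr// /d.
  rewrite -[ltRHS]invrK ltf_pV2 ?posrE ?invr_gt0 ?divr_gt0//.
  rewrite -[n.+1%:R]natr1 ltr_pwDr//; near: n; exact: nbhs_infty_ger.
have r20 : 0 < r / 2 by rewrite divr_gt0.
apply: filterS (filterI dU
  (filterI (unif t (r / 2) t0 r20) (filterI (bndU t t0) (solU t)))) =>
  n [dn [yx [[yb yl] [cy _ _ yE]]]].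
rewrite (yE t (lexx _)) /delayed_step max_l// opprD addrACA subrr add0r.
have cfx : continuous (fun s => f (x s)).
  by move=> s; apply: continuous_comp; [exact: cx|exact: cf].
have cfy := continuous_delayed (d := d n) cf cy.
apply: (@le_trans _ _ (W * e' * t * (t - 0))); last first.
  rewrite subr0 /e' (_ : W * _ * t * t = e * ((W * t * t) / (W * t * t + 1))); last by ring.
  by rewrite ler_piMr ?ltW// ltr_pdivrMr// mul1r ltrDl.
apply: Rintegral_dist => //; try exact: wconv_continuous.
move=> u /andP[u0 ut].
apply: (@le_trans _ _ (W * e' * u)); last first.
  by rewrite ler_wpM2l// mulr_ge0// ltW.
apply: wconv_dist => // [v /andP[v0 vu]|s /andP[s0 su]].
  by apply: hW; rewrite v0 (le_trans vu).
apply/ltW/hr; first by apply: xbnd => //; exact: le_trans ut.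
have st : s <= t by exact: le_trans ut.
have -> : x s - y n (s - d n) = (x s - y n s) + (y n s - y n (s - d n)) by ring.
apply: le_lt_trans (ler_normD _ _) _.
have h1 : `|x s - y n s| <= r / 2 by apply: yx; rewrite s0.
have /andP[h2 h3] := yl (s - d n) s (ltac:(by rewrite gerBl ltW)) st.
rewrite (ger0_norm h2) [ltRHS]splitr ler_ltD//.
apply: le_lt_trans h3 _; apply: le_lt_trans dn.
by rewrite opprB addrC subrK ler_wpM2r ?lerDl// ltW.
Unshelve. all: by end_near. Qed.

End Existence.

(** * Comparison functions for f *)

Section Reduction.
Variable R : realType.
Local Notation mu := (@lebesgue_measure R).
Implicit Types (f g x : R -> R) (a b t u v : R).

(** Meant for truncations [g] with values in [A]: they turn the functions of the problem, continuous
    on an interval, into functions continuous on the line. *)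
Lemma continuous_clip (A : set R) g x : continuous g -> (forall t, A (g t)) ->
  {within A, continuous x} -> continuous (fun t => x (g t)).
Proof.
move=> cg Ag /subspace_continuousP cx t; apply/cvgrPdist_lt => e e0.
have /cvgrPdist_lt/(_ e e0) := cx _ (Ag t).
rewrite near_withinE => h.
near=> u; suff : A (g u) -> `|x (g t) - x (g u)| < e by apply; exact: Ag.
by near: u; exact: (cg t _ h).
Unshelve. all: by end_near. Qed.

Lemma continuous_max_cst a : continuous (fun t => Num.max t a).
Proof. by move=> t; apply: continuous_max; [exact: cvg_id|exact: cvg_cst]. Qed.

Lemma continuous_clip_pos f b : 0 < b -> {within `]0, +oo[, continuous f} ->
  continuous (fun u => f (Num.max u b)).
Proof.
move=> b0 cf; apply: (continuous_clip (@continuous_max_cst b) _ cf) => t.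
by rewrite /= in_itv/= andbT lt_max b0 orbT.
Qed.

(** The ratio of [f] to the increasing function [phi] is within [1/2] of 1 far out, and on the
    remaining segment from [b] compactness bounds it above and away from 0. If it lies between [c]
    and [C], then [Phi = C phi] and [K = C / c]. *)
Lemma comparable_majorant f b : 0 < b -> {within `]0, +oo[, continuous f} ->
  (forall u, 0 < u -> 0 < f u) -> asymp_increasing f ->
  exists K Phi, [/\ 0 < K, {homo Phi : u v / u <= v},
    forall u, f (Num.max u b) <= Phi u &
    forall u, Phi u <= K * f (Num.max u b)].
Proof.
move=> b0 cf f0 [phi [cphi [phi0 [phi_incr /cvgrPdist_lt lim]]]].
have [X [_ hX]] := lim 2^-1 (ltac:(by rewrite invr_gt0)).
have pb u : 0 < Num.max u b by rewrite lt_max b0 orbT.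
pose r u := f (Num.max u b) / phi (Num.max u b).
have r0 u : 0 < r u by rewrite divr_gt0 ?f0 ?phi0.
have cr : continuous r.
  move=> u; apply: cvgM; first exact: (continuous_clip_pos b0 cf).
  by apply: cvgV; [rewrite gt_eqF ?phi0|exact: (continuous_clip_pos b0 cphi)].
have [M M0 hM] := continuous_bounded_segment b X cr.
have [m m0 hm] := continuous_pos_segment b X cr r0.
have rb u : Num.min m 2^-1 <= r u <= Num.max M 2.
  have -> : r u = r (Num.max u b) by rewrite /r -maxA maxxx.
  have ub : b <= Num.max u b by rewrite le_max lexx orbT.
  have [uX|Xu] := leP (Num.max u b) X.
    rewrite ge_min hm ?ub//= le_max (le_trans (ler_norm _)) ?hM ?ub//.
  have := hX _ Xu; rewrite /r -maxA maxxx ltr_norml => /andP[h1 h2].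
  by rewrite ge_min le_max; apply/andP; split; apply/orP; right; lra.
have c0 : 0 < Num.min m 2^-1 by rewrite lt_min m0/= invr_gt0.
have C0 : 0 < Num.max M 2 by rewrite lt_max M0.
exists (Num.max M 2 / Num.min m 2^-1), (fun u => Num.max M 2 * phi (Num.max u b)).
split; first by rewrite divr_gt0.
- move=> u v uv; rewrite ler_wpM2l ?(ltW C0)//.
  have : Num.max u b <= Num.max v b by rewrite ge_max !le_max uv lexx/= orbT.
  by rewrite le_eqVlt => /predU1P[->//|/(phi_incr _ _ (pb u))/ltW].
- by move=> u; rewrite -ler_pdivrMr ?phi0//; have /andP[] := rb u.
- move=> u; rewrite -mulrA ler_wpM2l ?(ltW C0)// mulrC ler_pdivlMr// mulrC.
  by rewrite -ler_pdivlMr ?phi0//; have /andP[] := rb u.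
Qed.

(** * The Osgood condition and its primitives *)

Section Osgood.
Variables (f : R -> R) (b : R).
Hypotheses (b0 : 0 < b) (cf : {within `]0, +oo[, continuous f}).
Hypothesis f_gt0 : forall u, 0 < u -> 0 < f u.
Hypothesis osgood : forall eta, 0 < eta ->
  (\int[mu]_(u in `[eta, +oo[) (osgood_integrand f u)%:E = +oo)%E.
Local Notation fb := (fun u => f (Num.max u b)).

(** Stated in the extended reals, since it serves to prove that [int0 f b] is finite. *)
Lemma int0_split P u : (forall v, is_derive v 1 P (fb v)) -> b <= u ->
  int0 f u = (int0 f b + (P u - P b)%:E)%E.
Proof.
move=> dP bu; have cfb := continuous_clip_pos b0 cf.
rewrite /int0 (@itv_bndbnd_setU _ _ (BRight 0) (BRight b) (BRight u)) ?bnd_simp ?(ltW b0)//.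
rewrite ge0_integral_setU//=.
- congr (_ + _)%E.
  rewrite -(Rintegral_primitive cfb dP bu) /Rintegral fineK; last first.
    by apply: integrable_fin_num => //; exact: continuous_segment_integrable.
  rewrite -integral_itv_obnd_cbnd; last first.
    apply: (measurable_int mu).
    apply: integrableS (@continuous_segment_integrable R _ b u cfb) => //.
    exact: subset_itv_oc_cc.
  apply: eq_integral => s; rewrite inE/= in_itv/= => /andP[bs _].
  by rewrite max_l// ltW.
- apply/measurable_EFinP; rewrite -itv_bndbnd_setU ?bnd_simp ?(ltW b0)//.
  have mf : measurable_fun `](0 : R), +oo[ f.
    apply: open_continuous_measurable_fun; first exact: interval_open.
    by move: cf; rewrite continuous_open_subspace//; exact: interval_open.
  apply: measurable_funS mf => //.
  by move=> s; rewrite /= !in_itv/= => /andP[-> _].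
- move=> s [] /=; rewrite in_itv/= => /andP[sb _]; rewrite lee_fin ltW// f_gt0//.
  exact: lt_trans sb.
- apply/disj_setPLR => s/=; rewrite !in_itv/= => /andP[_ sb].
  by apply/negP; rewrite negb_and -leNgt sb.
Qed.

(** Were it infinite, so would be every [int0 f u] with [u >= b]; the Osgood integrand would then
    vanish on [[b, +oo[] by convention, and its integral could not diverge. *)
Lemma int0_fin_num : int0 f b \is a fin_num.
Proof.
have [P dP] := primitive_exists (continuous_clip_pos b0 cf).
have ge0 : (0 <= int0 f b)%E.
  apply: integral_ge0 => s; rewrite /= in_itv/= => /andP[s0 _].
  by rewrite lee_fin ltW ?f_gt0.
case E : (int0 f b) ge0 => [r||]//= _.
have := osgood b0; suff -> : (\int[mu]_(u in `[b, +oo[) (osgood_integrand f u)%:E = 0)%E by [].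
apply: integral0_eq => u; rewrite /= in_itv/= andbT => bu.
by rewrite /osgood_integrand (int0_split dP bu) E.
Qed.

(** [F] is the integral of [f] from 0, once past [b]; the gap [b < a] makes it positive from [a] on.
    [G] is unbounded because a bounded monotone [G] would converge, and the Osgood integral over
    [[a, +oo[] would be finite. *)
Lemma osgood_primitives a : b < a -> exists F G : R -> R, [/\
  forall u, is_derive u 1 F (fb u),
  forall u, a <= u -> 0 < F u,
  forall u, a <= u -> is_derive u 1 G (Num.sqrt (F u))^-1,
  forall M, exists X, forall u, G u <= M -> u <= X &
  forall u v, a <= u -> u <= v ->
    Rintegral mu `[u, v] (osgood_integrand f) = G v - G u].
Proof.
move=> ba; have cfb := continuous_clip_pos b0 cf.
have [P dP] := primitive_exists cfb.
pose F u := fine (int0 f b) + (P u - P b).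
have fb_gt0 u : 0 < fb u by rewrite f_gt0// lt_max b0 orbT.
have dF u : is_derive u 1 F (fb u).
  rewrite -[fb u]add0r; apply: is_deriveD.
  by rewrite -[fb u]subr0; apply: is_deriveB.
have F_gt0 u : a <= u -> 0 < F u.
  move=> au; have bu : b < u by exact: lt_le_trans au.
  apply: ltr_wpDl.
    apply: fine_ge0; apply: integral_ge0 => s; rewrite /= in_itv/= => /andP[s0 _].
    by rewrite lee_fin ltW ?f_gt0.
  have dP' t : t \in `]b, u[ -> is_derive t 1 P (fb t) by [].
  have [c _ ->] := MVT bu dP' (continuous_subspaceT (is_derive_continuousT dP)).
  by rewrite mulr_gt0// subr_gt0.
(* Truncating at [a] keeps the root positive, so [q] is continuous and has a primitive on the whole
   line. *)
pose q u := (Num.sqrt (F (Num.max u a)))^-1.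
have cq : continuous q.
  move=> u; apply: cvgV.
    by rewrite gt_eqF// sqrtr_gt0 F_gt0// le_max lexx orbT.
  apply: continuous_comp; last exact: sqrt_continuous.
  apply: continuous_comp; first exact: continuous_max_cst.
  exact: is_derive_continuous (dF _).
have q0 u : 0 <= q u by rewrite invr_ge0 sqrtr_ge0.
have qE u : a <= u -> osgood_integrand f u = q u.
  move=> au; rewrite /osgood_integrand (int0_split dP); last first.
    by rewrite (le_trans (ltW ba)).
  by rewrite -[int0 f b]fineK ?int0_fin_num//= /q max_l// div1r.
have [G dG] := primitive_exists cq.
have G_homo : {homo G : u v / u <= v}.
  move=> u v uv; rewrite -subr_ge0.
  have := increment_ge uv (continuous_subspaceT (is_derive_continuousT dG))
    (fun t _ => dG t) (fun t _ => q0 t).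
  by rewrite mul0r.
exists F, G; split => //.
- by move=> u au; have := dG u; rewrite /q max_l.
- move=> M; have [[X MX]|nX] := pselect (exists X, M < G X).
    exists X => u uM; rewrite leNgt; apply/negP => /ltW/G_homo Xu.
    by have := lt_le_trans MX (le_trans Xu uM); rewrite ltxx.
  have /nondecreasing_cvgr -/(_ G_homo) Gl : has_ubound (range G).
    exists M => _ [X _ <-]; rewrite leNgt; apply/negP => MX.
    by apply: nX; exists X.
  have a0 : 0 < a by exact: lt_trans ba.
  have := osgood a0.
  have -> : (\int[mu]_(u in `[a, +oo[) (osgood_integrand f u)%:E =
             \int[mu]_(u in `[a, +oo[) (q u)%:E)%E.
    by apply: eq_integral => u; rewrite inE/= in_itv/= andbT => au; rewrite qE.
  have -> // := ge0_continuous_FTC2y (fun u _ => q0 u) (continuous_subspaceT cq) Gl.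
  + exact/cvg_at_right_filter/(is_derive_continuous (dG a)).
  + by move=> u _; rewrite derive1E; exact: derive_val.
- move=> u v au uv; rewrite -(Rintegral_primitive cq dG uv).
  apply: eq_Rintegral => t; rewrite inE/= in_itv/= => /andP[ut _].
  exact: qE (le_trans au ut).
Qed.

End Osgood.
End Reduction.

(** * A priori bounds and growth *)

Section Bounds.
Variable R : realType.
Local Notation mu := (@lebesgue_measure R).
Variables (w f F G Phi : R -> R) (a x0 K : R).
Hypotheses (cw : continuous w) (w0 : forall t : R, t <= 0 -> w t = 0).
Hypotheses (w_ge0 : forall t : R, 0 <= w t).
Hypotheses (cf : continuous f) (f_gt0 : forall u : R, 0 < f u).
Hypotheses (dF : forall u : R, is_derive u 1 F (f u)).
Hypothesis F_gt0 : forall u : R, a <= u -> 0 < F u.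
Hypothesis dG : forall u : R, a <= u -> is_derive u 1 G (Num.sqrt (F u))^-1.
Hypothesis G_infty : forall M : R, exists X : R, forall u : R, G u <= M -> u <= X.
Hypotheses (K_gt0 : 0 < K) (Phi_homo : {homo Phi : u v / u <= v}).
Hypotheses (fPhi : forall u : R, f u <= Phi u).
Hypothesis PhiK : forall u : R, Phi u <= K * f u.
Hypothesis ax0 : a <= x0.
Implicit Types (x y h : R -> R) (s t u v T : R).

Let f_ge0 u : 0 <= f u. Proof. exact: ltW. Qed.

(** Starting at time 0, where the integral of [h] is zero, the energy condition is automatic with
    [z0 = x0]. A general [h] covers both true solutions and delayed approximations. *)
Lemma volterra_bound x h W T : 0 <= T -> 0 <= W ->
  (forall t, 0 <= t <= T -> w t <= W) ->
  {within `[0, T], continuous x} -> x 0 = x0 -> x0 <= x T ->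
  continuous h -> (forall t, 0 <= t <= T -> 0 <= h t <= Phi (x t)) ->
  (forall t, 0 < t < T -> is_derive t 1 x (wconv w h t)) ->
  G (x T) <= G x0 + Num.sqrt (2 * (W * K)) * T.
Proof.
move=> T0 W0 wW cx xx0 x0T ch hPhi dx.
have [P dP] := primitive_exists ch.
pose H t := P t - P 0.
have dH t : is_derive t 1 H (h t) by rewrite -[h t]subr0; apply: is_deriveB.
have := @integral_inequality_bound R F f G a dF F_gt0 dG x (wconv w h) h H Phi
  W K 0 T x0 T0 W0 (ltW K_gt0) Phi_homo PhiK cx dx.
rewrite subr0; apply => //.
- move=> t /andP[t0 tT]; apply: (wconv_le (H := P)) => //; first exact: ltW.
    by move=> s /andP[s0 st]; apply: wW; rewrite s0 (le_trans st)// ltW.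
  move=> s /andP[s0 st].
  by have /andP[] := hPhi s (ltac:(by rewrite s0 (le_trans st)// ltW)).
- move=> t /andP[t0 tT]; have := increment_ge t0
    (continuous_subspaceT (is_derive_continuousT dP)) (fun s _ => dP s) (c := 0).
  rewrite mul0r; apply => s /andP[s0 st].
  by have /andP[] := hPhi s (ltac:(by rewrite ltW//= (le_trans (ltW st)))).
- by move=> t /hPhi/andP[].
- by rewrite xx0.
- exact: le_trans x0T.
- by rewrite /H subrr mulr0 expr0n/= !mulr_ge0// ltW// F_gt0.
Qed.

Lemma delayed_solution_bounded T : 0 <= T -> exists M, forall d y, 0 < d ->
  delayed_solution w f x0 d T y -> y T <= M.
Proof.
move=> T0; have [W W0 hW] := continuous_bounded_segment 0 T cw.
have [M hM] := G_infty (G x0 + Num.sqrt (2 * (W * K)) * T).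
exists M => d y d0 [cy hy y0 yE]; apply: hM.
apply: (@volterra_bound y (fun s => f (y (s - d)))) => //.
- exact: ltW.
- by move=> t /hW; apply: le_trans; exact: ler_norm.
- exact: continuous_subspaceT.
- exact: y0.
- by rewrite -(y0 0 (lexx _)) hy.
- exact: (continuous_delayed (d := d) cf cy).
(* The approximation is nondecreasing, so the delayed value is at most the present one, and the
   bound does not see [d]. *)
- move=> t _; rewrite f_ge0/=; apply: le_trans (fPhi _) _.
  by apply/Phi_homo/hy; rewrite gerBl ltW.
- move=> t /andP[t0 tT].
  have [P dP PE] := delayed_step_primitive x0 cw w0 cf d cy.
  have dQ : is_derive t 1 (fun t => x0 + (P t - P 0))
      (wconv w (fun s => f (y (s - d))) t).
    rewrite -[wconv _ _ _]add0r; apply: is_deriveD.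
    by rewrite -[wconv _ _ _]subr0; apply: is_deriveB.
  apply: near_eq_is_derive dQ; near=> s.
  rewrite yE; last by apply/ltW; near: s; exact: lt_nbhsl.
  by rewrite PE max_l//; apply/ltW; near: s; exact: lt_nbhsr.
Unshelve. all: by end_near. Qed.

Lemma volterra_solution_exists : exists x, [/\ continuous x,
  forall t, x0 <= x t, x 0 = x0 &
  forall t, 0 < t -> is_derive t 1 x (wconv w (fun s => f (x s)) t)].
Proof.
have [x [cx x0x xE]] := volterra_exists cw w0 w_ge0 cf f_ge0 delayed_solution_bounded.
exists x; split => //; first by rewrite xE// set_itv1 Rintegral_set1 addr0.
move=> t t0.
have cc : continuous (wconv w (fun s => f (x s))).
  apply: wconv_continuous => // s.
  by apply: continuous_comp; [exact: cx|exact: cf].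
have [P dP] := primitive_exists cc.
have dQ : is_derive t 1 (fun t => x0 + (P t - P 0)) (wconv w (fun s => f (x s)) t).
  rewrite -[wconv _ _ _]add0r; apply: is_deriveD.
  by rewrite -[wconv _ _ _]subr0; apply: is_deriveB.
apply: near_eq_is_derive dQ; near=> s.
have s0 : 0 <= s by apply/ltW; near: s; exact: lt_nbhsr.
by rewrite xE// (Rintegral_primitive cc dP).
Unshelve. all: by end_near. Qed.

(** One [M] serves all horizons [T' <= T], which is what excludes blow-up at [T] of a solution
    living on [[0, T[]. *)
Lemma solution_bounded T : exists M, forall T' x, 0 <= T' <= T ->
  continuous x -> x 0 = x0 -> x0 <= x T' ->
  (forall t, 0 < t < T' -> is_derive t 1 x (wconv w (fun s => f (x s)) t)) ->
  x T' <= M.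
Proof.
have [W W0 hW] := continuous_bounded_segment 0 T cw.
have [M hM] := G_infty (G x0 + Num.sqrt (2 * (W * K)) * T).
exists M => T' x /andP[T'0 T'T] cx xx0 x0T dx; apply: hM.
apply: (@le_trans _ _ (G x0 + Num.sqrt (2 * (W * K)) * T')); last first.
  by rewrite lerD2l ler_wpM2l// sqrtr_ge0.
apply: (@volterra_bound x (fun s => f (x s))) => //.
- exact: ltW.
- move=> t /andP[t0 tT]; apply: le_trans (ler_norm _) _.
  by rewrite hW// t0 (le_trans tT).
- exact: continuous_subspaceT.
- by move=> t; apply: continuous_comp; [exact: cx|exact: cf].
- by move=> t _; rewrite f_ge0 fPhi.
Qed.

(** * Superexponential growth and growth rate of a solution *)

Section Growth.
Variables (x : R -> R) (delta N m : R).
Hypotheses (cx : continuous x) (x_init : forall t, t <= 0 -> x t = x0).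
Hypothesis dx : forall t, 0 < t ->
  is_derive t 1 x (wconv w (fun s => f (x s)) t).
Hypothesis f_superlinear : forall A : R, exists X : R, forall u, X <= u -> A * u <= f u.
Hypotheses (m_gt0 : 0 < m) (m_f : forall u, m <= f u).
Hypotheses (delta_gt0 : 0 < delta) (w_gt0 : forall t, 0 < t <= delta -> 0 < w t).
Hypothesis w_int : forall P : R -> R, (forall t, is_derive t 1 P (w t)) ->
  forall t, 0 <= t -> P t - P 0 <= N.
Hypothesis x0_gt0 : 0 < x0.

Let cfx : continuous (fun s => f (x s)).
Proof. by move=> t; apply: continuous_comp; [exact: cx|exact: cf]. Qed.

Lemma solution_homo : {homo x : s t / s <= t}.
Proof.
have hpos s t : 0 <= s -> s <= t -> x s <= x t.
  move=> s0 st; rewrite -subr_ge0.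
  have dx' u : s < u < t -> is_derive u 1 x (wconv w (fun s => f (x s)) u).
    by move=> /andP[su _]; apply: dx; exact: le_lt_trans su.
  have := increment_ge st (continuous_subspaceT cx) dx' (c := 0).
  by rewrite mul0r; apply => u _; apply: wconv_ge0.
move=> s t st; have [s0|/ltW s0] := leP 0 s; first exact: hpos.
rewrite (x_init s0); have [t0|/ltW t0] := leP t 0; first by rewrite x_init.
by rewrite -(x_init (lexx 0)) hpos.
Qed.

(* Only the part [t - e, t] of the memory is kept. *)
Lemma wconv_lower P e c t : (forall u, is_derive u 1 P (w u)) ->
  0 <= e <= t -> (forall s, t - e <= s <= t -> c <= f (x s)) ->
  c * (P e - P 0) <= wconv w (fun s => f (x s)) t.
Proof.
move=> dP /andP[e0 et] cfs.
have ci := @continuous_wconv_integrand R w (fun s => f (x s)) t cw cfx.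
have [A dA] := primitive_exists ci.
have cA := is_derive_continuousT dA.
have t0 : 0 <= t by exact: le_trans et.
rewrite /wconv (Rintegral_primitive ci dA t0).
have h1 : A 0 <= A (t - e).
  rewrite -subr_ge0; have te : 0 <= t - e by rewrite subr_ge0.
  have := increment_ge te (continuous_subspaceT cA) (fun s _ => dA s) (c := 0).
  by rewrite mul0r; apply => s _; rewrite mulr_ge0.
(* Its derivative [w (t - s) * (f (x s) - c)] is nonnegative on [[t - e, t]]; comparing end points
   replaces a change of variables. *)
pose B s := A s + c * P (t - s).
have dB s : is_derive s 1 B (w (t - s) * f (x s) - c * w (t - s)).
  have dts : is_derive s 1 (fun s => t - s) (-1).
    by rewrite -sub0r; apply: is_deriveB.
  have dPt : is_derive s 1 (P \o (fun s => t - s)) (w (t - s) * -1).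
    exact: is_derive1_comp (dP _) dts.
  rewrite (_ : - (c * w (t - s)) = c *: (w (t - s) * -1)); last first.
    by rewrite /GRing.scale/= mulrN1 mulrN.
  exact: is_deriveD (dA s) (is_deriveZ c dPt).
have tet : t - e <= t by rewrite gerBl.
have := increment_ge tet (continuous_subspaceT (is_derive_continuousT dB))
  (fun s _ => dB s) (c := 0).
rewrite mul0r => /(_ _) h2.
have {}h2 : 0 <= B t - B (t - e).
  apply: h2 => s /andP[s1 s2]; rewrite mulrC -mulrBl mulr_ge0// subr_ge0.
  by rewrite cfs// !ltW.
by move: h2; rewrite /B subrr subKr mulrBr; lra.
Qed.

Lemma wprimitive_gt0 P e : (forall u, is_derive u 1 P (w u)) ->
  0 < e <= delta -> 0 < P e - P 0.
Proof.
move=> dP /andP[e0 ed].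
have dP' t : t \in `]0, e[ -> is_derive t 1 P (w t) by [].
have [c + ->] := MVT e0 dP' (continuous_subspaceT (is_derive_continuousT dP)).
rewrite in_itv/= => /andP[c0 ce].
by rewrite mulr_gt0 ?subr_gt0// w_gt0// c0/= (le_trans (ltW ce)).
Qed.

(** From time [delta] on, [x'] is at least [m] times the integral of [w] over [[0, delta]], so
    growth is at least linear. *)
Lemma solution_cvgy : x t @[t --> +oo] --> +oo.
Proof.
have [P dP] := primitive_exists cw.
have k0 : 0 < P delta - P 0 by apply: wprimitive_gt0 => //; rewrite delta_gt0/=.
set k := P delta - P 0 in k0.
apply/cvgryPge => A.
exists (delta + Num.max 0 A / (m * k)); split; first exact: num_real.
move=> t tA.
have A0 : 0 <= Num.max 0 A by rewrite le_max lexx.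
have mk0 : 0 < m * k by rewrite mulr_gt0.
have dt : delta <= t.
  by apply: le_trans (ltW tA); rewrite lerDl divr_ge0// ltW.
have dx' u : delta < u < t -> is_derive u 1 x (wconv w (fun s => f (x s)) u).
  by move=> /andP[su _]; apply: dx; exact: lt_trans su.
have h : m * k * (t - delta) <= x t - x delta.
  apply: (increment_ge dt (continuous_subspaceT cx) dx') => u /andP[du _].
  by apply: wconv_lower => //; rewrite !ltW.
have h2 : Num.max 0 A <= m * k * (t - delta).
  by rewrite mulrC -ler_pdivrMr// lerBrDl ltW.
have h3 : A <= Num.max 0 A by rewrite le_max lexx orbT.
have h4 : x0 <= x delta.
  by rewrite -(x_init (lexx 0)); apply: solution_homo; exact: ltW.
apply: (le_trans h3); apply: (le_trans h2); apply: (le_trans h).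
by rewrite gerBl (le_trans (ltW x0_gt0)).
Qed.

(** For [u] in [[t - h, t]] the window [[u - h, u]] lies in [[t - e, t]], where
    [f (x s) >= A * x (t - e)]. Hence [x' >= A * k * x (t - e)] on an interval of length [h], and
    [x t >= A * k * h * x (t - e)]; superlinearity allows any [A]. *)
Lemma solution_superexp_growth : superexp_growth x.
Proof.
have x_gt0 t : 0 < x t.
  apply: (lt_le_trans x0_gt0); have [t0|/ltW t0] := leP t 0; first by rewrite x_init.
  by rewrite -(x_init (lexx 0)) solution_homo.
split; first exact: continuous_subspaceT.
split => //; split; first exact: solution_cvgy.
move=> e e0; apply/cvgrPdist_le => eta eta0.
(* Two windows of length [h] must fit into [e], and [h <= delta] makes [w] positive on the
   window. *)
pose h := Num.min (e / 2) delta.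
have h0 : 0 < h by rewrite lt_min divr_gt0.
have he : h <= e / 2 by rewrite ge_min lexx.
have hd : h <= delta by rewrite ge_min lexx orbT.
have [P dP] := primitive_exists cw.
have k0 : 0 < P h - P 0 by apply: wprimitive_gt0 => //; rewrite h0.
set k := P h - P 0 in k0.
pose A := (eta * k * h)^-1.
have A0 : 0 < A by rewrite invr_gt0 !mulr_gt0.
have [X hX] := f_superlinear A.
have [T [_ hT]] := (cvgryPge _).1 solution_cvgy X.
exists (Num.max T 0 + 1 + e); split; first exact: num_real.
move=> t tT; rewrite sub0r normrN ger0_norm; last by rewrite divr_ge0// ltW.
rewrite ler_pdivrMr//.
have T0 : T <= Num.max T 0 by rewrite le_max lexx.
have T1 : 0 <= Num.max T 0 by rewrite le_max lexx orbT.
have ht : t - h <= t by rewrite gerBl ltW.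
have dx' u : t - h < u < t -> is_derive u 1 x (wconv w (fun s => f (x s)) u).
  by move=> /andP[su _]; apply: dx; lra.
have hh : A * x (t - e) * k * (t - (t - h)) <= x t - x (t - h).
  apply: (increment_ge ht (continuous_subspaceT cx) dx') => u /andP[ut _].
  apply: wconv_lower => //; first by rewrite ltW//=; lra.
  move=> s /andP[s1 s2]; apply: (@le_trans _ _ (A * x s)).
    by rewrite ler_wpM2l// ?(ltW A0)// solution_homo//; lra.
  by apply/hX/hT; lra.
have {}hh : A * k * h * x (t - e) <= x t.
  rewrite (_ : A * k * h * _ = A * x (t - e) * k * h); last by ring.
  by move: hh; rewrite subKr => /le_trans; apply; rewrite gerBl ltW.
have -> : x (t - e) = eta * (A * k * h * x (t - e)).
  by rewrite /A; field; rewrite !gt_eqF.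
by rewrite ler_wpM2l// ltW.
Qed.

Hypothesis f_superexp : forall eps, 0 < eps ->
  f (x (t - eps)) / f (x t) @[t --> +oo] --> (0 : R).

(* The recent past [t - e, t] dominates the rest of the memory, and there [w] is small. *)
Lemma wconv_upper eta H : 0 < eta ->
  (forall t, is_derive t 1 H (f (x t))) -> H 0 = 0 ->
  exists2 T, 0 <= T & forall t, T <= t ->
    wconv w (fun s => f (x s)) t <= 2 * eta * H t.
Proof.
move=> eta0 dH H0.
have cH := is_derive_continuousT dH.
have [e e0 we] : exists2 e, 0 < e & forall t, 0 <= t <= e -> w t <= eta.
  have [d d0 hd] := unif_continuous_segment 0 0 cw eta0.
  exists (d / 2); first by rewrite divr_gt0.
  move=> t /andP[t0 td].
  have : `|w 0 - w t| < eta.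
    by apply: hd; rewrite ?lexx// sub0r normrN ger0_norm//; lra.
  by rewrite w0// sub0r normrN => /ltW; apply: le_trans; exact: ler_norm.
have [P dP] := primitive_exists cw.
have N0 : 0 <= N by have := w_int dP (lexx 0); rewrite subrr.
have N1 : 0 < N + 1 by rewrite ltr_wpDl.
(* Chosen so that the bound [K * rho * f (x (t - e / 2)) * (N + 1)] for the older past equals [eta]
   times the lower bound [h3] of [H t]. *)
pose rho := eta * (e / 2) / (K * K * (N + 1)).
have rho0 : 0 < rho by rewrite divr_gt0 ?mulr_gt0// divr_gt0.
have e20 : 0 < e / 2 by rewrite divr_gt0.
have /cvgrPdist_le/(_ rho rho0)[T [_ hT]] := f_superexp e20.
exists (Num.max T 0 + 1 + e) => [|t tT].
  by rewrite !addr_ge0// ?le_max ?lexx ?orbT// ltW.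
have T0 : T <= Num.max T 0 by rewrite le_max lexx.
have T1 : 0 <= Num.max T 0 by rewrite le_max lexx orbT.
have t0 : 0 <= t by lra.
have Phi_ge0 u : 0 <= Phi u by exact: le_trans (fPhi u).
have h1 : wconv w (fun s => f (x s)) t <= eta * H t + Phi (x (t - e)) * N.
  have ci := @continuous_wconv_integrand R w (fun s => f (x s)) t cw cfx.
  (* The first term majorises the integrand on the recent past, the second on the older past; adding
     them avoids splitting the integral. *)
  pose g s := eta * f (x s) + Phi (x (t - e)) * w (t - s).
  have cg : continuous g.
    move=> s; apply: cvgD.
      by apply: cvgM; [exact: cvg_cst|exact: cfx].
    apply: cvgM; first exact: cvg_cst.
    apply: continuous_comp; last exact: cw.
    by apply: cvgB; [exact: cvg_cst|exact: cvg_id].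
  apply: (@le_trans _ _ (Rintegral mu `[0, t] g)).
    apply: le_Rintegral_segment => // s /andP[s0 st].
    have [ste|ste] := leP (t - e) s.
      rewrite /g ler_wpDr ?mulr_ge0// ler_wpM2r// we//; lra.
    rewrite /g ler_wpDl ?mulr_ge0// ?(ltW eta0)// mulrC ler_wpM2r//.
    apply: le_trans (fPhi _) _; apply: Phi_homo; apply: solution_homo; exact: ltW.
  pose Q s := eta * H s - Phi (x (t - e)) * P (t - s).
  have dQ s : is_derive s 1 Q (g s).
    have dts : is_derive s 1 (fun s => t - s) (-1).
      by rewrite -sub0r; apply: is_deriveB.
    have dPt : is_derive s 1 (P \o (fun s => t - s)) (w (t - s) * -1).
      exact: is_derive1_comp (dP _) dts.
    rewrite (_ : g s = eta *: f (x s) - Phi (x (t - e)) *: (w (t - s) * -1)).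
      exact: is_deriveB (is_deriveZ eta (dH s)) (is_deriveZ (Phi (x (t - e))) dPt).
    by rewrite /g /GRing.scale/= mulrN1 mulrN opprK.
  rewrite (Rintegral_primitive cg dQ t0) /Q subrr subr0 H0 mulr0.
  have : Phi (x (t - e)) * (P t - P 0) <= Phi (x (t - e)) * N.
    by rewrite ler_wpM2l// w_int.
  by rewrite mulrBr; lra.
(* The window is halved: between [t - e] and [t - e / 2] the factor [rho] is gained, and the
   integral over [[t - e / 2, t]] bounds [H t] from below. *)
have h2 : f (x (t - e)) <= rho * f (x (t - e / 2)).
  have := hT (t - e / 2) (ltac:(lra)).
  rewrite sub0r normrN ger0_norm; last by rewrite divr_ge0.
  by rewrite ler_pdivrMr// (_ : t - e / 2 - e / 2 = t - e)//; lra.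
have h3 : K^-1 * f (x (t - e / 2)) * (e / 2) <= H t.
  have te : t - e / 2 <= t by rewrite gerBl ltW.
  have te0 : 0 <= t - e / 2 by lra.
  have i1 := increment_ge te0 (continuous_subspaceT cH) (fun s _ => dH s) (c := 0)
    (fun s _ => f_ge0 _).
  have := increment_ge te (continuous_subspaceT cH) (fun s _ => dH s)
    (c := K^-1 * f (x (t - e / 2))).
  rewrite subKr => i2.
  suff : K^-1 * f (x (t - e / 2)) * (e / 2) <= H t - H (t - e / 2).
    by move: i1; rewrite mul0r H0; lra.
  apply: i2 => s /andP[s1 s2]; rewrite ler_pdivrMl//.
  apply: le_trans (PhiK _); apply: le_trans (fPhi _) _.
  by apply: Phi_homo; apply: solution_homo; exact: ltW.
have h4 : Phi (x (t - e)) * N <= eta * H t.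
  apply: (@le_trans _ _ (K * (rho * f (x (t - e / 2))) * (N + 1))).
    apply: ler_pM => //; last by rewrite lerDl.
    by apply: le_trans (PhiK _) _; rewrite ler_wpM2l// ltW.
  rewrite (_ : K * _ * _ = eta * (K^-1 * f (x (t - e / 2)) * (e / 2))).
    by rewrite ler_wpM2l// ltW.
  by rewrite /rho; field; rewrite !gt_eqF.
lra.
Qed.

Lemma F_unbounded C : exists2 z, x0 <= z & C <= F z.
Proof.
exists (x0 + `|C| / m); first by rewrite lerDl divr_ge0// ltW.
have h : x0 <= x0 + `|C| / m by rewrite lerDl divr_ge0// ltW.
have := increment_ge h (continuous_subspaceT (is_derive_continuousT dF))
  (fun s _ => dF s) (fun s _ => m_f s).
rewrite [x0 + _]addrC addrK mulrC divfK ?gt_eqF//.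
by have := F_gt0 ax0; have := ler_norm C; lra.
Qed.

Lemma solution_growth eps : 0 < eps ->
  exists T, forall t, T <= t -> G (x t) <= eps * t.
Proof.
move=> eps0.
have [P dP] := primitive_exists cfx.
pose H t := P t - P 0.
have dH t : is_derive t 1 H (f (x t)).
  by rewrite -[f (x t)]subr0; apply: is_deriveB.
have H0 : H 0 = 0 by rewrite /H subrr.
have H_ge0 t : 0 <= t -> 0 <= H t.
  move=> t0; have := increment_ge t0
    (continuous_subspaceT (is_derive_continuousT dP)) (fun s _ => dP s) (c := 0).
  by rewrite mul0r; apply => s _; exact: f_ge0.
(* With [c = 2 * eta] the slope [sqrt (2 * c * K)] is exactly [eps / 2]; the other half of [eps]
   absorbs the constant [G z1]. *)
pose eta := (eps / 2) ^+ 2 / (4 * K).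
have eta0 : 0 < eta by rewrite divr_gt0 ?exprn_gt0 ?divr_gt0 ?mulr_gt0.
have [T T0 hT] := wconv_upper eta0 dH H0.
(* [z0] is chosen large enough to absorb the kinetic energy at time [T] *)
have [z0 x0z0 Fz0] := F_unbounded ((2 * eta * H T) ^+ 2 / (2 * (2 * eta * K))).
have c0 : 0 < 2 * (2 * eta * K) by rewrite mulr_gt0// mulr_gt0// mulr_gt0.
have FM u v : a <= u -> u <= v -> F u <= F v.
  move=> au uv; rewrite -subr_ge0.
  have := increment_ge uv (continuous_subspaceT (is_derive_continuousT dF))
    (fun s _ => dF s) (fun s _ => f_ge0 s) (c := 0).
  by rewrite mul0r.
pose z1 := Num.max z0 (x T).
have z01 : z0 <= z1 by rewrite le_max lexx.
have az0 : a <= z0 by exact: le_trans x0z0.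
have bnd t : T <= t -> G (x t) <= G z1 + eps / 2 * (t - T).
  move=> Tt.
  have sq : Num.sqrt (2 * (2 * eta * K)) = eps / 2.
    rewrite (_ : 2 * (2 * eta * K) = (eps / 2) ^+ 2).
      by rewrite sqrtr_sqr gtr0_norm// divr_gt0.
    by rewrite /eta; field; rewrite gt_eqF.
  rewrite -sq.
  apply: (@integral_inequality_bound R F f G a dF F_gt0 dG x
    (wconv w (fun s => f (x s))) (fun s => f (x s)) H Phi) => //.
  - by rewrite mulr_ge0// ltW.
  - exact: ltW.
  - exact: continuous_subspaceT.
  - by move=> s /andP[Ts _]; apply: dx; exact: le_lt_trans Ts.
  - by move=> s /andP[Ts _]; apply: hT; exact: ltW.
  - by move=> s /andP[Ts _]; apply: H_ge0; exact: le_trans Ts.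
  - by rewrite /z1 le_max lexx orbT.
  - exact: le_trans z01.
  - apply: (le_trans ax0); rewrite -(x_init (lexx 0)); apply: solution_homo.
    exact: le_trans Tt.
  - move: Fz0; rewrite ler_pdivrMr// [F z0 * _]mulrC => /le_trans; apply.
    by rewrite ler_wpM2l ?(ltW c0)// FM.
exists (Num.max T (2 * `|G z1| / eps)) => t; rewrite ge_max => /andP[Tt Gt].
apply: le_trans (bnd _ Tt) _.
have h1 : 2 * `|G z1| <= eps * t by rewrite [eps * t]mulrC -ler_pdivrMr.
have h2 := ler_norm (G z1).
have h3 : 0 <= eps * T by rewrite mulr_ge0// ltW.
by rewrite mulrBr; lra.
Qed.

End Growth.
End Bounds.

(** * Solutions of the original equation *)

Section Solutions.
Variable R : realType.
Local Notation mu := (@lebesgue_measure R).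
Variables (f w : R -> R) (x0 : R).
Hypotheses (f_gt0 : forall u : R, 0 < u -> 0 < f u).
Hypotheses (w_ge0 : forall t : R, 0 <= t -> 0 <= w t).
Hypothesis x0_gt0 : 0 < x0.
Implicit Types (x : R -> R) (s t T : R).

Let clip T t := Num.min (Num.max t 0) T.

Let continuous_clipT T : continuous (clip T).
Proof.
move=> t; apply: (@continuous_min _ _ (fun t => Num.max t 0) (cst T)).
  exact: continuous_max_cst.
exact: cvg_cst.
Qed.

(** Monotonicity of [x] needs [f (x s) >= 0], known only where [x] is positive. The circle is broken
    at the first time [c] with [x c <= 0]: before it [x] is positive, hence [x' >= 0] and
    [x c >= x0 > 0]. *)
Lemma solution_ge_init T x : 0 <= T -> {within `[0, T], continuous x} ->
  x 0 = x0 ->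
  (forall t, 0 < t < T ->
     derivable x t 1 /\ derive1 x t = volterra_rhs w f x t) ->
  forall t, 0 <= t <= T -> x0 <= x t.
Proof.
move=> T0 cx xx0 dx.
have step t : 0 <= t <= T -> (forall s, 0 <= s < t -> 0 < x s) -> x0 <= x t.
  move=> /andP[t0 tT] xs; rewrite -xx0 -subr_ge0.
  have ct : {within `[0, t], continuous x}.
    by apply: continuous_subspaceW cx; exact: subset_itvl.
  have dt s : 0 < s < t -> is_derive s 1 x (volterra_rhs w f x s).
    move=> /andP[s0 st]; have [|d <-] := dx s; first by rewrite s0 (lt_le_trans st).
    by rewrite derive1E; exact/derivableP.
  have := increment_ge t0 ct dt (c := 0); rewrite mul0r; apply.
  move=> s /andP[s0 st]; apply: Rintegral_ge0 => r; rewrite /= in_itv/= => /andP[r0 rs].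
  rewrite mulr_ge0 ?w_ge0 ?subr_ge0// ltW// f_gt0// xs// r0/=.
  exact: le_lt_trans st.
have cxc : continuous (fun t => x (clip T t)).
  apply: continuous_clip (@continuous_clipT T) _ cx => t.
  by rewrite /= in_itv/= le_min ge_min T0 lexx orbT !le_max lexx orbT.
have clipE t : 0 <= t <= T -> clip T t = t.
  by move=> /andP[t0 tT]; rewrite /clip max_l// min_l.
suff pos t : 0 <= t <= T -> 0 < x t.
  move=> t tT; apply: step => // s /andP[s0 st]; apply: pos.
  by rewrite s0; have /andP[_] := tT; apply: le_trans; exact: ltW.
move=> tT; rewrite ltNge; apply/negP => xt.
(* The set of times with [x <= 0]; clipping the time exhibits it as compact, so it has a least
   element if nonempty. *)
pose A := `[0, T] `&` (fun t => x (clip T t)) @^-1` [set y | y <= 0].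
have cA : compact A.
  apply: compact_closedI; first exact: segment_compact.
  exact: (continuous_closedP _).1 cxc _ (@closed_le _ 0).
have A0 : A !=set0 by exists t; split => /=; [rewrite in_itv|rewrite clipE].
have [c] := compact_EVT_min A0 cA (continuous_subspaceT (fun t => @cvg_id _ (nbhs t))).
rewrite inE => -[/=]; rewrite in_itv/= => cT xc cmin.
have : x0 <= x c.
  apply: step => // s /andP[s0 sc]; rewrite ltNge; apply/negP => xs.
  have sT : 0 <= s <= T.
    by rewrite s0; have /andP[_] := cT; apply: le_trans; exact: ltW.
  have /cmin : s \in A by rewrite inE; split => /=; [rewrite in_itv|rewrite clipE].
  by rewrite leNgt sc.
by rewrite leNgt (le_lt_trans _ x0_gt0)//; rewrite clipE in xc.
Qed.

Variable b : R.
Hypothesis b_le : b <= x0.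
Local Notation fb := (fun u => f (Num.max u b)).
Local Notation wp := (fun t => w (Num.max t 0)).

(** Both truncations are inactive here: [x] stays above [b], and [t - s] is nonnegative. [y] stands
    for a version of [x] clipped in time. *)
Lemma volterra_rhs_wconv x y t : (forall s, 0 <= s <= t -> x0 <= x s) ->
  (forall s, 0 <= s <= t -> y s = x s) ->
  volterra_rhs w f x t = wconv wp (fun s => fb (y s)) t.
Proof.
move=> xs yx; apply: eq_Rintegral => s; rewrite inE/= in_itv/= => st.
rewrite yx// [Num.max (x s) b]max_l ?(le_trans b_le)// ?xs//.
by rewrite max_l// subr_ge0; case/andP: st.
Qed.

Lemma clipped_solution T x y : 0 <= T -> {within `[0, T], continuous x} ->
  x 0 = x0 ->
  (forall t, 0 < t < T ->
     derivable x t 1 /\ derive1 x t = volterra_rhs w f x t) ->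
  (forall t, 0 <= t <= T -> y t = x t) ->
  forall t, 0 < t < T -> is_derive t 1 y (wconv wp (fun s => fb (y s)) t).
Proof.
move=> T0 cx xx0 dx yx t /andP[t0 tT].
have xge := solution_ge_init T0 cx xx0 dx.
have [|d dE] := dx t; first by rewrite t0.
have sT s : 0 <= s <= t -> 0 <= s <= T.
  by move=> /andP[-> st]; rewrite (le_trans st)// ltW.
rewrite -(@volterra_rhs_wconv x y t); last 2 first.
- by move=> s /sT; exact: xge.
- by move=> s /sT; exact: yx.
have dx' : is_derive t 1 x (volterra_rhs w f x t).
  by rewrite -dE derive1E; exact/derivableP.
apply: near_eq_is_derive dx'; near=> s.
apply/esym/yx/andP; split; apply: ltW; near: s; [exact: lt_nbhsr|exact: lt_nbhsl].
Unshelve. all: by end_near. Qed.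

(** For each [t < T] the solution frozen after time [t] is continuous on the line and solves the
    truncated equation up to [t]; the bound [M] does not depend on [t]. *)
Lemma local_solution_bounded T x : continuous wp -> continuous fb ->
  (exists M, forall T' x, 0 <= T' <= T ->
    continuous x -> x 0 = x0 -> x0 <= x T' ->
    (forall t, 0 < t < T' -> is_derive t 1 x (wconv wp (fun s => fb (x s)) t)) ->
    x T' <= M) ->
  local_solution w f x0 T x ->
  (forall t, 0 <= t < T -> x0 <= x t) /\ exists M, forall t, 0 <= t < T -> x t <= M.
Proof.
move=> cw cf [M hM] [cx [xx0 dx]].
have cxt t : t < T -> {within `[0, t], continuous x}.
  move=> tT; apply: continuous_subspaceW cx => s; rewrite /= !in_itv/=.
  by move=> /andP[-> /le_lt_trans]; apply.
have dxt t : t < T -> forall s, 0 < s < t ->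
    derivable x s 1 /\ derive1 x s = volterra_rhs w f x s.
  by move=> tT s /andP[s0 st]; apply: dx; rewrite s0 (lt_trans st).
have xge t : 0 <= t < T -> x0 <= x t.
  move=> /andP[t0 tT].
  by apply: (solution_ge_init t0 (cxt _ tT) xx0 (dxt _ tT)); rewrite t0 lexx.
split => //; exists M => t t0T; have /andP[t0 tT] := t0T.
have clipE s : 0 <= s <= t -> x (clip t s) = x s.
  by move=> /andP[s0 st]; rewrite /clip max_l// min_l.
have tt : 0 <= t <= t by rewrite t0 lexx.
rewrite -(clipE t tt); apply: (hM t (fun s => x (clip t s))).
- by rewrite t0 ltW.
- apply: continuous_clip (@continuous_clipT t) _ (cxt _ tT) => s.
  by rewrite /= in_itv/= le_min ge_min t0 lexx orbT !le_max lexx orbT.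
- by rewrite clipE ?lexx ?t0.
- by rewrite clipE// xge.
- exact: clipped_solution t0 (cxt _ tT) xx0 (dxt _ tT) clipE.
Qed.

End Solutions.

(** Integrability of [w] enters here: it bounds the weight of the distant past uniformly in [t]. *)
Lemma primitive_le_integral (R : realType) (w P : R -> R) :
  {within `[0, +oo[, continuous w} -> (forall t, 0 <= t -> 0 <= w t) ->
  (@lebesgue_measure R).-integrable `[0, +oo[ (EFin \o w) ->
  (forall t : R, is_derive t 1 P (w (Num.max t 0))) ->
  forall t : R, 0 <= t ->
    P t - P 0 <= Rintegral (@lebesgue_measure R) `[0, +oo[ w.
Proof.
move=> cw w0 iw dP t t0.
have cwp : continuous (fun t : R => w (Num.max t 0)).
  apply: continuous_clip (@continuous_max_cst R 0) _ cw => s.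
  by rewrite /= in_itv/= andbT le_max lexx orbT.
rewrite -(Rintegral_primitive cwp dP t0).
have -> : Rintegral (@lebesgue_measure R) `[0, t] (fun s => w (Num.max s 0)) =
    Rintegral (@lebesgue_measure R) `[0, t] w.
  apply: eq_Rintegral => s; rewrite inE/= in_itv/= => /andP[s0 _].
  by rewrite max_l.
have sub : `[0, t] `<=` `[0, +oo[%classic.
  by move=> s; rewrite /= !in_itv/= => /andP[->].
apply: fine_le.
- apply: integrable_fin_num => //; exact: integrableS iw.
- exact: integrable_fin_num.
- apply: ge0_subset_integral => //; first exact: (measurable_int _ iw).
  by move=> s; rewrite /= in_itv/= andbT => s0; rewrite lee_fin w0.
Qed.

(** For [m], compactness handles a segment from [b], and beyond it superlinearity with [A = 1] gives
    [f u >= u >= b]. *)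
Lemma superlinear_lower_bounds (R : realType) (f : R -> R) (b : R) : 0 < b ->
  {within `]0, +oo[, continuous f} -> (forall u, 0 < u -> 0 < f u) ->
  (f x / x @[x --> +oo] --> +oo) ->
  (forall A : R, exists X : R, forall u, X <= u -> A * u <= f (Num.max u b)) /\
  exists2 m, 0 < m & forall u, m <= f (Num.max u b).
Proof.
move=> b0 cf f0 /cvgryPge lim.
have sl A : exists X : R, forall u, X <= u -> A * u <= f (Num.max u b).
  have [X [_ hX]] := lim A.
  exists (Num.max b (X + 1)) => u; rewrite ge_max => /andP[bu Xu].
  have u0 : 0 < u by exact: lt_le_trans bu.
  rewrite max_l// -ler_pdivlMr//; apply: hX.
  by apply: lt_le_trans Xu; rewrite ltrDl.
split => //; have [X hX] := sl 1.
have fb0 u : 0 < f (Num.max u b) by rewrite f0// lt_max b0 orbT.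
have [m m0 hm] := continuous_pos_segment b X (continuous_clip_pos b0 cf) fb0.
exists (Num.min m b) => [|u]; first by rewrite lt_min m0.
have bu : b <= Num.max u b by rewrite le_max lexx orbT.
have -> : f (Num.max u b) = f (Num.max (Num.max u b) b) by rewrite -maxA maxxx.
have [uX|/ltW Xu] := leP (Num.max u b) X.
  by rewrite ge_min hm// bu.
by rewrite ge_min; apply/orP; right; rewrite (le_trans bu)// -[leLHS]mul1r hX.
Qed.

Theorem theorem3p3 (R : realType) (f w : R -> R) :
  {within `]0, +oo[, continuous f} ->
  (forall x, 0 < x -> 0 < f x) ->
  asymp_increasing f ->
  (f x / x @[x --> +oo] --> +oo) ->
  {within `[0, +oo[, continuous w} ->
  (forall t, 0 <= t -> 0 <= w t) ->
  (@lebesgue_measure R).-integrable `[0, +oo[ (EFin \o w) ->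
  w 0 = 0 ->
  (exists2 delta, 0 < delta & forall t, 0 < t <= delta -> 0 < w t) ->
  (forall eta, 0 < eta ->
     (\int[@lebesgue_measure R]_(u in `[eta, +oo[) (osgood_integrand f u)%:E
        = +oo)%E) ->
  forall x0, 0 < x0 ->
    (* global existence *)
    (exists x, global_solution w f x0 x /\ forall t, 0 <= t -> 0 < x t) /\
    (* every solution on [0,T) is positive and does not blow up *)
    (forall T x, 0 < T -> local_solution w f x0 T x ->
       (forall t, 0 <= t < T -> 0 < x t) /\
       (exists M, forall t, 0 <= t < T -> x t <= M)) /\
    (* every solution on [0,oo) is positive *)
    (forall x, global_solution w f x0 x -> forall t, 0 <= t -> 0 < x t) /\
    (* growth rate, when f preserves superexponential growth *)
    (preserves_superexp f ->
       forall x, global_solution w f x0 x ->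
         F_U f (x t) / t @[t --> +oo] --> (0:R)).
Proof.
move=> cf f0 f_incr f_sl cw w_ge0 w_int w00 [delta delta0 w_pos] osgood x0 x0_gt0.
(* Solutions stay above x0 > b, so clipping f at b and w at 0 changes nothing
   and makes every integrand continuous on the whole line. *)
pose a := Num.min x0 1; pose b := a / 2.
have a0 : 0 < a by rewrite lt_min x0_gt0/=.
have b0 : 0 < b by rewrite divr_gt0.
have ba : b < a by rewrite ltr_pdivrMr// ltr_pMr// ltr1n.
have ax0 : a <= x0 by rewrite ge_min lexx.
(* The base point 1 of [F_U] must lie where [G] is a primitive of the Osgood integrand. *)
have a1 : a <= 1 by rewrite ge_min lexx orbT.
have bx0 : b <= x0 by exact: le_trans (ltW ba) ax0.
have [K [Phi [K0 Phi_homo fPhi PhiK]]] := comparable_majorant b0 cf f0 f_incr.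
have [F [G [dF F0 dG G_infty FU]]] := osgood_primitives b0 cf f0 osgood ba.
have cfb := continuous_clip_pos b0 cf.
have fb0 u : 0 < f (Num.max u b) by rewrite f0// lt_max b0 orbT.
have cwp : continuous (fun t : R => w (Num.max t 0)).
  apply: continuous_clip (@continuous_max_cst R 0) _ cw => s.
  by rewrite /= in_itv/= andbT le_max lexx orbT.
have wp0 t : t <= 0 -> w (Num.max t 0) = 0 by move=> t0; rewrite max_r.
have wp_ge0 t : 0 <= w (Num.max t 0) by rewrite w_ge0// le_max lexx orbT.
have sol_bnd := solution_bounded cwp cfb fb0 dF F0 dG G_infty K0 Phi_homo fPhi PhiK ax0.
have loc T x : 0 < T -> local_solution w f x0 T x ->
    (forall t, 0 <= t < T -> x0 <= x t) /\
    exists M, forall t, 0 <= t < T -> x t <= M.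
  move=> T0 sx.
  exact: (local_solution_bounded f0 w_ge0 x0_gt0 bx0 cwp cfb (sol_bnd T) sx).
have glob x : global_solution w f x0 x -> forall t, 0 <= t -> x0 <= x t.
  move=> [cx [xx0 dx]] t t0.
  apply: (@solution_ge_init R f w x0 f0 w_ge0 x0_gt0 t x) => //.
  - by apply: continuous_subspaceW cx => s; rewrite /= !in_itv/= => /andP[->].
  - by move=> s /andP[s0 _]; exact: dx.
  - by rewrite t0 lexx.
split; [|split; [|split]].
- have [x [cx x0x xx0 dx]] := volterra_solution_exists cwp wp0 wp_ge0 cfb fb0
    dF F0 dG G_infty K0 Phi_homo fPhi PhiK ax0.
  exists x; split; last by move=> t _; exact: lt_le_trans x0_gt0 _.
  split; first exact: continuous_subspaceT.
  split => // t t0; have d := dx t t0; split; first exact: ex_derive.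
  rewrite derive1E (@derive_val _ _ _ _ _ _ _ d).
  by rewrite (@volterra_rhs_wconv R f w x0 b bx0 x x t).
- move=> T x T0 /(loc T x T0)[xge xM]; split => // t /xge.
  exact: lt_le_trans.
- by move=> x /glob xge t /xge; exact: lt_le_trans.
move=> f_superexp x sx; have xge := glob x sx.
have [cx [xx0 dx]] := sx.
(* Extending by the initial value to negative times gives continuity and monotonicity on the whole
   line. *)
pose y t := x (Num.max t 0).
have cy : continuous y.
  apply: continuous_clip (@continuous_max_cst R 0) _ cx => s.
  by rewrite /= in_itv/= andbT le_max lexx orbT.
have yx t : 0 <= t -> y t = x t by move=> t0; rewrite /y max_l.
have y_init t : t <= 0 -> y t = x0 by move=> t0; rewrite /y max_r.
have yge t : x0 <= y t by rewrite xge// le_max lexx orbT.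
have dy (t : R) : 0 < t ->
    is_derive t 1 y (wconv (fun t : R => w (Num.max t 0)) (fun s => f (Num.max (y s) b)) t).
  move=> t0.
  apply: (@clipped_solution R f w x0 f0 w_ge0 x0_gt0 b bx0 (t + 1) x y) => //.
  - by rewrite addr_ge0// ltW.
  - by apply: continuous_subspaceW cx => s; rewrite /= !in_itv/= => /andP[->].
  - by move=> s /andP[s0 _]; exact: dx.
  - by move=> s /andP[s0 _]; exact: yx.
  - by rewrite t0 ltrDl/=.
have [fb_sl [m m0 hm]] := superlinear_lower_bounds b0 cf f0 f_sl.
have wp_gt0 t : 0 < t <= delta -> 0 < w (Num.max t 0).
  by move=> /andP[t0 td]; rewrite max_l ?ltW// w_pos// t0.
have wpN P := primitive_le_integral cw w_ge0 w_int (P := P).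
have y_cvg : y t @[t --> +oo] --> +oo.
  exact: (solution_cvgy cwp wp_ge0 cfb fb0 cy y_init dy m0 hm delta0 wp_gt0 x0_gt0).
have y_super : superexp_growth y.
  exact: (solution_superexp_growth cwp wp_ge0 cfb fb0 cy y_init dy fb_sl m0 hm
    delta0 wp_gt0 x0_gt0).
have fb_super (e : R) : 0 < e ->
    f (Num.max (y (t - e)) b) / f (Num.max (y t) b) @[t --> +oo] --> (0 : R).
  move=> e0; have -> : (fun t : R => f (Num.max (y (t - e)) b) / f (Num.max (y t) b)) =
      (fun t => f (y (t - e)) / f (y t)).
    by apply/funext => t; rewrite !max_l// (le_trans bx0).
  exact: f_superexp.
have growth := solution_growth cwp wp0 wp_ge0 cfb fb0 dF F0 dG K0 Phi_homo fPhi
  PhiK ax0 cy y_init dy m0 hm wpN fb_super.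
apply/cvgrPdist_le => e e0.
have e20 : 0 < e / 2 by rewrite divr_gt0.
have [T hT] := growth _ e20.
have [S [_ hS]] := (cvgryPge _).1 y_cvg 1.
(* Beyond [S] the solution exceeds 1, which selects the first branch of [F_U]; beyond the last bound
   the constant [- G 1] costs at most [e / 2 * t]. *)
exists (Num.max (Num.max T S) (Num.max 1 (`|G 1| / (e / 2)))); split; first exact: num_real.
move=> t; rewrite !gt_max => /andP[/andP[Tt St] /andP[t1 Gt]].
have t0 : 0 < t by exact: lt_trans t1.
have x1 : 1 <= x t by rewrite -yx ?(ltW t0)// hS.
rewrite sub0r normrN /F_U x1 FU//.
have G1 : G 1 <= G (x t) by exact: (osgood_primitive_homo dG).
rewrite ger0_norm; last by rewrite divr_ge0 ?subr_ge0// ltW.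
rewrite ler_pdivrMr//.
have := hT t (ltW Tt); rewrite yx ?(ltW t0)// => h1.
have : `|G 1| <= t * (e / 2) by rewrite -ler_pdivrMr// ltW.
have := ler_norm (- G 1); rewrite normrN; lra.
Qed.
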